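(* There is a polynomial time algorithm that, given a connected finite graph $G=(V,E)$ (multiple edges allowed, no loops) and an effective divisor $D$ on $G$ of degree $k$ with $\operatorname{rank}(D)\geq 1$, outputs a tree decomposition of $G$ of width at most $k$.
   Context: Let $G=(V,E)$ be a connected finite graph (parallel edges allowed, no loops). Its Laplacian $Q\in\mathbb{Z}^{V\times V}$ has $Q_{uu}=\deg(u)$ and $Q_{uv}=-(\text{number of edges between }u\text{ and }v)$ for $u\neq v$. A divisor is a vector $D\in\mathbb{Z}^V$; its degree is $\deg(D)=\sum_{v}D(v)$; it is effective if $D(v)\geq 0$ for all $v$. Two divisors $D,D'$ are equivalent ($D\sim D'$) if $D'=D-Qx$ for some $x\in\mathbb{Z}^V$. We say $\operatorname{rank}(D)\geq 1$ if $D$ is equivalent to an effective divisor and, for every vertex $v$, $D-\mathbf{1}_v$ is equivalent to an effective divisor (here $\mathbf{1}_v$ is the indicator vector of $v$). A tree decomposition of $G$ is a pair $(T,(X_i)_{i\in I})$ with $T=(I,F)$ a tree and $X_i\subseteq V$, such that $\bigcup_i X_i=V$, every edge has both ends in some $X_i$, and for each $v\in V$ the set $\{i: v\in X_i\}$ induces a connected subtree of $T$; its width is $\max_i|X_i|-1$. *)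

(* Defs.v *)
From HB Require Import structures.
From mathcomp Require Import all_boot all_order all_algebra.

Set Implicit Arguments.
Unset Strict Implicit.
Unset Printing Implicit Defensive.

Import Order.TTheory GRing.Theory Num.Theory.

(** * Multigraphs, divisors, tree decompositions *)

(* Each edge is listed once, in an arbitrary orientation; parallel edges are
   repeated (possibly with opposite orientations). *)
Record multigraph := Multigraph {
  nverts : nat;
  edges : seq ('I_nverts * 'I_nverts);
  _ : all (fun e => e.1 != e.2) edges
}.

Notation vertex G := 'I_(nverts G).

Section Multigraph.
Variable G : multigraph.
Implicit Types u v : vertex G.

Definition edge_mult u v : nat :=
  count (fun e => (e == (u, v)) || (e == (v, u))) (edges G).

Definition degree u : nat :=
  count (fun e => (e.1 == u) || (e.2 == u)) (edges G).

Definition adjacent : rel (vertex G) := [rel u v | 0 < edge_mult u v].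

(* The subgraph induced by S is connected; the empty set is allowed here. *)
Definition induces_connected (S : {set vertex G}) : Prop :=
  forall u v, u \in S -> v \in S ->
    connect [rel a b | [&& adjacent a b, a \in S & b \in S]] u v.

Definition connected : Prop :=
  0 < nverts G /\ forall u v, connect adjacent u v.

(* A simple graph has no cycle on three or more vertices; since [adjacent] is
   symmetric and irreflexive, a [ucycle] of size 2 is a single edge. *)
Definition is_tree : Prop :=
  [/\ forall u v, edge_mult u v <= 1,
      connected
    & forall c : seq (vertex G), ucycle adjacent c -> size c <= 2].

Local Open Scope ring_scope.

Definition laplacian : 'M[int]_(nverts G) :=
  \matrix_(u, v) if u == v then (degree u)%:Z else - (edge_mult u v)%:Z.

Definition divisor : Type := 'cV[int]_(nverts G).

Definition div_degree (D : divisor) : int := \sum_v D v 0.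

Definition effective (D : divisor) : Prop := forall v, 0 <= D v 0.

Definition equivalent (D D' : divisor) : Prop :=
  exists x : 'cV[int]_(nverts G), D' = D - laplacian *m x.

Definition equivalent_to_effective (D : divisor) : Prop :=
  exists2 D' : divisor, equivalent D D' & effective D'.

Definition rank_ge1 (D : divisor) : Prop :=
  equivalent_to_effective D /\
  forall v, equivalent_to_effective (D - delta_mx v 0).

End Multigraph.

Definition tree_decomposition (G T : multigraph)
    (X : vertex T -> {set vertex G}) : Prop :=
  [/\ is_tree T,
      \bigcup_i X i = [set: vertex G],
      forall e, e \in edges G -> exists i, (e.1 \in X i) && (e.2 \in X i)
    & forall v, induces_connected [set i | v \in X i]].

(* The truncated predecessor is harmless: when G is nonempty some bag is. *)
Definition width (G T : multigraph) (X : vertex T -> {set vertex G}) : nat :=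
  (\max_i #|X i|).-1.

(** * Deterministic multi-tape Turing machines *)

Section TuringMachines.
(* The input/output alphabet. *)
Variable A : finType.

Variant move := MoveLeft | Stay | MoveRight.

(* [None] is the blank; a machine may use additional working symbols. *)
Definition cell (W : finType) : finType := option (A + W).

(* The machine has [tapes.+1] tapes; tape [ord0] holds the input and the
   output. *)
Record machine := Machine {
  tapes : nat;
  work : finType;
  state : finType;
  start : state;
  halting : pred state;
  delta : state -> {ffun 'I_tapes.+1 -> cell work} ->
          state * ('I_tapes.+1 -> cell work * move)
}.

(* A two-way infinite tape: [to_left] lists the cells to the left of the head,
   nearest first; [from_head] lists the scanned cell and those to its right.
   All the other cells are blank. *)
Record tape (W : finType) := Tape {
  to_left : seq (cell W);
  from_head : seq (cell W)
}.

Definition scanned W (t : tape W) : cell W := head None (from_head t).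

Definition write_move W (t : tape W) (am : cell W * move) : tape W :=
  let: (a, m) := am in
  let: Tape l r := t in
  match m with
  | MoveLeft => Tape (behead l) (head None l :: a :: behead r)
  | Stay => Tape l (a :: behead r)
  | MoveRight => Tape (a :: l) (behead r)
  end.

Record config (M : machine) := Config {
  cur_state : state M;
  cur_tape : 'I_(tapes M).+1 -> tape (work M)
}.

Definition step (M : machine) (c : config M) : config M :=
  if halting (cur_state c) then c else
  let: (q, act) := delta (cur_state c) [ffun i => scanned (cur_tape c i)] in
  Config q (fun i => write_move (cur_tape c i) (act i)).

Definition initial (M : machine) (w : seq A) : config M :=
  Config (start M)
    (fun i => Tape [::] (if i == ord0 then [seq Some (inl a) | a <- w]
                         else [::])).

(* The word written from the head on, up to the first cell that does not hold
   an input/output symbol. *)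
Fixpoint output_word W (s : seq (cell W)) : seq A :=
  if s is Some (inl a) :: s' then a :: output_word s' else [::].

Definition outputs_within (M : machine) (w : seq A) (t : nat) (out : seq A) :
    Prop :=
  let c := iter t (@step M) (initial M w) in
  halting (cur_state c) /\ output_word (from_head (cur_tape c ord0)) = out.

End TuringMachines.

(** * Encodings *)

(* Words over {0, 1, #}: [Some b] is a bit and [None] is the separator #. *)
Definition symbol : finType := option bool.

(* Binary digits, least significant first, followed by #; 0 is written 0#. *)
Definition encode_nat (n : nat) : seq symbol :=
  rcons [seq Some (odd (n %/ 2 ^ i)) | i <- iota 0 (trunc_log 2 n).+1] None.

Definition encode_nats (s : seq nat) : seq symbol :=
  flatten [seq encode_nat n | n <- s].

Definition graph_data (G : multigraph) : seq nat :=
  nverts G :: size (edges G) ::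
  flatten [seq [:: val e.1; val e.2] | e <- edges G].

(* Only used for effective divisors, where the absolute value loses nothing. *)
Definition divisor_data (G : multigraph) (D : divisor G) : seq nat :=
  [seq `|D v ord0|%N | v <- enum 'I_(nverts G)].

Definition encode_instance (G : multigraph) (D : divisor G) : seq symbol :=
  encode_nats (graph_data G ++ divisor_data D).

(* The tree, then the 0/1 characteristic vectors of the bags. *)
Definition encode_decomposition (G T : multigraph)
    (X : vertex T -> {set vertex G}) : seq symbol :=
  encode_nats (graph_data T ++
    flatten [seq [seq nat_of_bool (v \in X i) | v <- enum 'I_(nverts G)]
            | i <- enum 'I_(nverts T)]).

(* Main.v *)
Require Import Defs.
From mathcomp Require Import all_boot all_order all_algebra.
From mathcomp Require Import zify ring.

(**
  For a vertex [v] without chips, fire the largest legal set avoiding [v] until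
  [v] receives a chip. If [D - Qx] is effective with a chip on [v], the top
  level set of [x] is legal, so each firing lowers [max x - x v]; since [x]
  varies by at most [deg D] along an edge, [v] is hit after at most [n * deg D]
  rounds. Adjacent vertices without chips have the same largest legal set, hence
  a whole component of the complement of the support is pursued in the same way.

  Order the vertices by the round in which they are hit, then by the least
  fired neighbour that hits them. In the tree decomposition given by this
  elimination order, the bag of [v] consists of vertices hit together with [v]
  by fired vertices up to the least one hitting [v], each paid for by a chip of
  its fired neighbour, of the remaining fired vertices, and of unfired vertices
  carrying chips: at most [deg D + 1] vertices in all. If [deg D >= n], any
  order will do, so chip numbers may be truncated.

  Polynomial time functions are the ones computed by a five-stack machine acting
  on binary trees on top of its main stack; they are closed under composition,
  pairing, case distinction and folds with polynomially bounded states.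
*)

Set Implicit Arguments.
Unset Strict Implicit.
Unset Printing Implicit Defensive.

Import Order.TTheory GRing.Theory Num.Theory.

(** * Structured programs over five stacks *)

(** The 1 in the width count comes from the tie-break. In the round that hits [v], a fired vertex
    might have to pay twice, for itself and for the vertices it hits. Let [j] be the least fired
    neighbour of [v]. A fired member of the bag touches a vertex of the component explored from [v];
    that vertex is hit in the same round and is not earlier than [v], so the fired member is at
    least [j]. An unfired, chipless member is hit in this round too and, being earlier, has a fired
    neighbour at most [j]. So fired vertices below [j] pay only for vertices they hit, those above
    [j] only for themselves, and [j] alone counts twice. Pursuits of different vertices may pass
    through different divisors; one of them suffices for the count because the whole component
    shares it up to the round of [v]. The time bounds must hold for every list of numbers, not only
    for encodings of instances. This forces the caps on chip numbers and parsed values, and fixed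
    numbers of rounds in place of searches. *)

Variant reg := IO | MS | SA | SB | FS.

(** [IO] carries input and output, [MS] the trees being computed with, [SA] and [SB] are scratch
    space for moving trees, and [FS] holds the flags that drive loops. *)
Record memory := Mem {
  io : seq symbol; ms : seq symbol; sa : seq symbol; sb : seq symbol;
  fs : seq symbol
}.

Definition get (m : memory) (r : reg) : seq symbol :=
  match r with
  | IO => io m | MS => ms m | SA => sa m | SB => sb m | FS => fs m
  end.

Definition put (m : memory) (r : reg) (s : seq symbol) : memory :=
  let: Mem a b c d e := m in
  match r with
  | IO => Mem s b c d e
  | MS => Mem a s c d e
  | SA => Mem a b s d e
  | SB => Mem a b c s e
  | FS => Mem a b c d s
  end.

Definition pop (m : memory) (r : reg) : memory := put m r (behead (get m r)).

Definition push (m : memory) (r : reg) (a : symbol) : memory := put m r (a :: get m r).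

Notation sym0 := (Some false : symbol).
Notation sym1 := (Some true : symbol).
Notation symH := (None : symbol).

(* [Case] pops a symbol and branches on it (first branch: empty stack);
   [While] pops a symbol and goes on as long as it is a 1. *)
Inductive cmd :=
  | Skip
  | Push of reg & symbol
  | Seq of cmd & cmd
  | Case of reg & cmd & cmd & cmd & cmd
  | While of reg & cmd.

Declare Scope cmd_scope.
Delimit Scope cmd_scope with cmd.
Bind Scope cmd_scope with cmd.
Notation "c ;; d" := (Seq c d) (at level 60, right associativity) : cmd_scope.

Definition branch (T : Type) (a : option symbol) (xe x0 x1 xh : T) : T :=
  match a with
  | None => xe
  | Some (Some false) => x0
  | Some (Some true) => x1
  | Some None => xh
  end.

(* The time is the exact number of steps of the compiled Turing machine: a
   push takes one step and a pop takes two. *)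
Inductive exec : cmd -> memory -> nat -> memory -> Prop :=
  | ExecSkip m : exec Skip m 1 m
  | ExecPush r a m : exec (Push r a) m 1 (push m r a)
  | ExecSeq c1 c2 m t1 m1 t2 m2 :
      exec c1 m t1 m1 -> exec c2 m1 t2 m2 -> exec (Seq c1 c2) m (t1 + t2) m2
  | ExecCase r ce c0 c1 ch m t m' :
      exec (branch (ohead (get m r)) ce c0 c1 ch) (pop m r) t m' ->
      exec (Case r ce c0 c1 ch) m t.+2 m'
  | ExecStop r c m :
      ohead (get m r) != Some sym1 -> exec (While r c) m 2 (pop m r)
  | ExecLoop r c m t m1 t' m' :
      ohead (get m r) == Some sym1 ->
      exec c (pop m r) t m1 -> exec (While r c) m1 t' m' ->
      exec (While r c) m (2 + (t + t')) m'.

Lemma get_set m r s r' : get (put m r s) r' =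
  if (r, r') is ((IO, IO) | (MS, MS) | (SA, SA) | (SB, SB) | (FS, FS))
  then s else get m r'.
Proof. by case: m r r' => a b c d e [] []. Qed.

(** A step pushes at most one symbol. A time bound is thereby also a bound on the size of the
    result, which is what makes composition work. *)
Lemma exec_size c m t m' r :
  exec c m t m' -> size (get m' r) <= size (get m r) + t.
Proof.
elim=> {c m t m'}.
- by move=> m; lia.
- by move=> r0 a m; rewrite /push get_set; case: r0; case: r => /=; lia.
- by move=> c1 c2 m t1 m1 t2 m2 _ + _; lia.
- move=> r0 ce c0 c1 ch m t m' _; rewrite /pop get_set.
  by case: r0; case: r => /=; rewrite ?size_behead; lia.
- move=> r0 c m _; rewrite /pop get_set.
  by case: r0; case: r => /=; rewrite ?size_behead; lia.
- move=> r0 c m t m1 t' m' _ _; rewrite /pop get_set.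
  by case: r0; case: r => /=; rewrite ?size_behead; lia.
Qed.

(** * Compilation to Turing machines *)

Variant instr :=
  | INop of nat
  | IPush of reg & symbol & nat
  | IPop of reg & nat & nat & nat & nat.

Fixpoint csize (c : cmd) : nat :=
  match c with
  | Skip => 1
  | Push _ _ => 1
  | Seq c1 c2 => csize c1 + csize c2
  | Case _ ce c0 c1 ch => (csize ce + csize c0 + csize c1 + csize ch).+1
  | While _ c => (csize c).+1
  end.

(* The code of [c] placed at address [o] and jumping to [k] when it is done. *)
Fixpoint compile (c : cmd) (o k : nat) : seq instr :=
  match c with
  | Skip => [:: INop k]
  | Push r a => [:: IPush r a k]
  | Seq c1 c2 => compile c1 o (o + csize c1) ++ compile c2 (o + csize c1) k
  | Case r ce c0 c1 ch =>
      let oe := o.+1 in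
      let o0 := oe + csize ce in
      let o1 := o0 + csize c0 in
      let oh := o1 + csize c1 in
      IPop r oe o0 o1 oh ::
        compile ce oe k ++ compile c0 o0 k ++ compile c1 o1 k ++ compile ch oh k
  | While r c => IPop r k k o.+1 k :: compile c o.+1 o
  end.

Lemma size_compile c o k : size (compile c o k) = csize c.
Proof.
elim: c o k => //=.
- by move=> c1 IH1 c2 IH2 o k; rewrite size_cat IH1 IH2.
- by move=> r ce IHe c0 IH0 c1 IH1 ch IHh o k; rewrite !size_cat IHe IH0 IH1 IHh; lia.
- by move=> r c IH o k; rewrite IH.
Qed.

Definition code_at (P : seq instr) (o : nat) (C : seq instr) : Prop :=
  exists P1 P2, P = P1 ++ C ++ P2 /\ size P1 = o.

Lemma code_at_catl P o C1 C2 : code_at P o (C1 ++ C2) -> code_at P o C1.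
Proof. by case=> P1 [P2 [-> <-]]; exists P1, (C2 ++ P2); rewrite !catA. Qed.

Lemma code_at_catr P o C1 C2 :
  code_at P o (C1 ++ C2) -> code_at P (o + size C1) C2.
Proof.
by case=> P1 [P2 [-> <-]]; exists (P1 ++ C1), P2; rewrite -!catA size_cat.
Qed.

Lemma code_at_head P o i C :
  code_at P o (i :: C) -> o < size P /\ nth (INop 0) P o = i.
Proof.
by case=> P1 [P2 [-> <-]]; rewrite nth_cat ltnn subnn size_cat /=; split=> //; lia.
Qed.

Lemma code_at_behead P o i C : code_at P o (i :: C) -> code_at P o.+1 C.
Proof. by rewrite -cat1s => /code_at_catr; rewrite addn1. Qed.

Section StackMachine.
Variable P : seq instr.

Notation tcell := (cell symbol void).

Definition reg_tape (r : reg) : 'I_5 :=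
  inord (match r with IO => 0 | MS => 1 | SA => 2 | SB => 3 | FS => 4 end).

Lemma reg_tape_inj : injective reg_tape.
Proof. by case; case=> // /(congr1 val) /=; rewrite !inordK. Qed.

Notation sm_state := ((bool * 'I_(size P).+1) + 'I_3)%type.

(* Before the program the head of the input tape moves to the end of the
   input; after the program it moves back to the beginning of the output. *)
Definition sm_seek : sm_state := inr (inord 0).
Definition sm_rewind : sm_state := inr (inord 1).
Definition sm_halt : sm_state := inr (inord 2).
(** The flag [b] marks the second step of a pop: the head already stands on the top symbol, which is
    now read and erased. *)
Definition sm_run (b : bool) (pc : nat) : sm_state := inl (b, inord pc).

Definition act (s : {ffun 'I_5 -> tcell}) (r : reg) (am : tcell * move)
    (i : 'I_5) : tcell * move :=
  if i == reg_tape r then am else (s i, Stay).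

Definition idle (s : {ffun 'I_5 -> tcell}) (i : 'I_5) : tcell * move :=
  (s i, Stay).

Definition sm_delta (q : sm_state) (s : {ffun 'I_5 -> tcell}) :
    sm_state * ('I_5 -> tcell * move) :=
  match q with
  | inr k =>
      let a := s (reg_tape IO) in
      match val k with
      | 0 => if a is Some _ then (sm_seek, act s IO (a, MoveRight))
             else (sm_run false 0, idle s)
      | 1 => if a is Some _ then (sm_rewind, act s IO (a, MoveLeft))
             else (sm_halt, act s IO (a, MoveRight))
      | _ => (sm_halt, idle s)
      end
  | inl (b, pc) =>
      (* The address just past the program is the exit. The head is one cell to the right of the
         output, so it first moves onto its last symbol. *)
      if pc == size P :> nat then
        (sm_rewind, act s IO (s (reg_tape IO), MoveLeft))
      else match nth (INop 0) P pc with
      | INop k => (sm_run false k, idle s)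
      | IPush r a k => (sm_run false k, act s r (Some (inl a), MoveRight))
      | IPop r ke k0 k1 kh =>
          if b then
            (sm_run false
               (match s (reg_tape r) with
                | Some (inl a) => branch (Some a) ke k0 k1 kh
                | _ => ke end),
             act s r (None, Stay))
          else (sm_run true pc, act s r (s (reg_tape r), MoveLeft))
      end
  end.

Definition stack_machine : machine symbol :=
  @Machine symbol 4 void sm_state sm_seek (pred1 sm_halt) sm_delta.

Notation conf := (config stack_machine).

Definition cells (s : seq symbol) : seq tcell := [seq Some (inl a) | a <- s].

(* A stack is stored to the left of the head, its top next to the head. *)
Definition holds_stack (t : tape symbol void) (s : seq symbol) : Prop :=
  to_left t = cells s /\ all (pred1 None) (from_head t).

Definition represents (c : conf) (m : memory) : Prop :=
  forall r, holds_stack (cur_tape c (reg_tape r)) (get m r).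

Lemma step_run (c : conf) (q : sm_state) :
  cur_state c = q -> q != sm_halt ->
  step c = let: (q', a) := sm_delta q [ffun i => scanned (cur_tape c i)] in
           @Config symbol stack_machine q' (fun i => write_move (cur_tape c i) (a i)).
Proof. by rewrite /step /= => -> /negPf ->. Qed.

Lemma holds_stack_idle t s :
  holds_stack t s -> holds_stack (write_move t (scanned t, Stay)) s.
Proof.
case: t => l [|a r] [/= -> /= Hr]; split=> //=.
Qed.

Lemma scanned_blank t s : holds_stack t s -> scanned t = None.
Proof. by case: t => l [|a r] [/= -> //= /andP[/eqP]]. Qed.

Lemma all_blank_behead (r : seq tcell) :
  all (pred1 None) r -> all (pred1 None) (behead r).
Proof. by case: r => //= a r /andP[]. Qed.

Lemma get_set_same m r s : get (put m r s) r = s.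
Proof. by case: m r => a b c d e []. Qed.

Lemma get_set_other m r s r' : r' <> r -> get (put m r s) r' = get m r'.
Proof. by case: m r r' => a b c d e [] []. Qed.

Lemma reg_eq (r r' : reg) : {r = r'} + {r <> r'}.
Proof. by decide equality. Qed.

Lemma sm_run_halt b pc : sm_run b pc != sm_halt.
Proof. by []. Qed.

Lemma sm_delta_run b pc s : pc < size P ->
  sm_delta (sm_run b pc) s =
  match nth (INop 0) P pc with
  | INop k => (sm_run false k, idle s)
  | IPush r a k => (sm_run false k, act s r (Some (inl a), MoveRight))
  | IPop r ke k0 k1 kh =>
      if b then
        (sm_run false
           (match s (reg_tape r) with
            | Some (inl a) => branch (Some a) ke k0 k1 kh
            | _ => ke end),
         act s r (None, Stay))
      else (sm_run true pc, act s r (s (reg_tape r), MoveLeft))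
  end.
Proof.
move=> Hpc; rewrite /sm_delta /sm_run inordK; last by lia.
by rewrite ltn_eqF.
Qed.

Lemma represents_act (c : conf) m r am s q :
  represents c m ->
  holds_stack (write_move (cur_tape c (reg_tape r)) am) s ->
  represents (@Config symbol stack_machine q
     (fun i => write_move (cur_tape c i)
        (act [ffun i => scanned (cur_tape c i)] r am i))) (put m r s).
Proof.
move=> Hm Hs r'; rewrite /= /act.
case: (reg_eq r' r) => [->|N].
  by rewrite eqxx get_set_same.
rewrite get_set_other //; case: eqP => [/reg_tape_inj //|_].
by rewrite ffunE; apply: holds_stack_idle.
Qed.

Lemma step_nop (c : conf) m o k :
  represents c m -> cur_state c = sm_run false o -> o < size P ->
  nth (INop 0) P o = INop k ->
  represents (step c) m /\ cur_state (step c) = sm_run false k.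
Proof.
move=> Hm Hq Ho Hi; rewrite (step_run Hq) ?sm_run_halt // sm_delta_run // Hi.
by split=> // r; rewrite /= /idle ffunE; apply: holds_stack_idle.
Qed.

Lemma step_push (c : conf) m o r a k :
  represents c m -> cur_state c = sm_run false o -> o < size P ->
  nth (INop 0) P o = IPush r a k ->
  represents (step c) (push m r a) /\ cur_state (step c) = sm_run false k.
Proof.
move=> Hm Hq Ho Hi; rewrite (step_run Hq) ?sm_run_halt // sm_delta_run // Hi.
split=> //; apply: represents_act => //.
case: (Hm r); case: (cur_tape c _) => l rt /= -> Hr.
by split=> //=; apply: all_blank_behead.
Qed.

(** No bottom marker is required: on an empty stack the head moves left over blank tape, and the
    tape still represents the empty stack. *)
Lemma step_pop (c : conf) m o r ke k0 k1 kh :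
  represents c m -> cur_state c = sm_run false o -> o < size P ->
  nth (INop 0) P o = IPop r ke k0 k1 kh ->
  represents (step (step c)) (pop m r) /\
  cur_state (step (step c)) =
    sm_run false (branch (ohead (get m r)) ke k0 k1 kh).
Proof.
move=> Hm Hq Ho Hi.
rewrite (step_run Hq) ?sm_run_halt // sm_delta_run // Hi.
set c1 := Config _ _.
have Hq1 : cur_state c1 = sm_run true o by [].
have Hr : holds_stack (write_move (cur_tape c1 (reg_tape r)) (None, Stay))
            (behead (get m r)) /\
   scanned (cur_tape c1 (reg_tape r)) =
     if get m r is a :: _ then Some (inl a) else None.
  rewrite /= /act eqxx ffunE; case: (Hm r).
  case: (cur_tape c _) => l rt /= -> /= Hr; rewrite /scanned /=.
  case: (get m r) => [|a s] /=; split=> //; split=> //=.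
  - by case: rt Hr => //= b rt /andP[-> ->].
  - by case: rt Hr => //= b rt /andP[-> ->].
rewrite (step_run Hq1) ?sm_run_halt // sm_delta_run // Hi.
split; last by rewrite /= ffunE Hr.2; case: (get m r).
move=> r'; rewrite /pop; case: (reg_eq r' r) => [->|N].
  have := Hr.1; rewrite get_set_same; congr (holds_stack _ _).
  by rewrite /= {3}/act eqxx.
rewrite get_set_other //= /act; case: eqP => [/reg_tape_inj //|_].
rewrite !ffunE ifN ?ffunE; last by apply/eqP => /reg_tape_inj.
by apply: holds_stack_idle; apply: holds_stack_idle.
Qed.

Lemma exec_compile c m t m' :
  exec c m t m' -> forall o k, code_at P o (compile c o k) ->
  forall cf : conf, represents cf m -> cur_state cf = sm_run false o ->
  represents (iter t (@step _ stack_machine) cf) m' /\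
  cur_state (iter t (@step _ stack_machine) cf) = sm_run false k.
Proof.
elim=> {c m t m'}.
- by move=> m o k /code_at_head[Ho Hi] cf Hm Hq; apply: step_nop Hq Ho Hi.
- by move=> r a m o k /code_at_head[Ho Hi] cf Hm Hq; apply: step_push Hq Ho Hi.
- move=> c1 c2 m t1 m1 t2 m2 _ IH1 _ IH2 o k Hc cf Hm Hq; rewrite /= in Hc.
  have [Hm1 Hq1] := IH1 _ _ (code_at_catl Hc) _ Hm Hq.
  rewrite addnC iterD; apply: IH2 Hm1 Hq1.
  by have := code_at_catr Hc; rewrite size_compile.
- move=> r ce c0 c1 ch m t m' _ IH o k Hc cf Hm Hq; rewrite /= in Hc.
  have [Ho Hi] := code_at_head Hc.
  have [Hm1 Hq1] := step_pop Hm Hq Ho Hi.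
  rewrite 2!iterSr; apply: IH Hm1 Hq1.
  have {}Hc := code_at_behead Hc.
  have He := code_at_catl Hc.
  have {}Hc := code_at_catr Hc; rewrite size_compile in Hc.
  have H0 := code_at_catl Hc.
  have {}Hc := code_at_catr Hc; rewrite size_compile in Hc.
  have H1 := code_at_catl Hc.
  have {}Hc := code_at_catr Hc; rewrite size_compile in Hc.
  by case: (ohead _) => [[[]|]|].
- move=> r c m Hr o k Hc cf Hm Hq; rewrite /= in Hc.
  have [Ho Hi] := code_at_head Hc.
  have [Hm1 Hq1] := step_pop Hm Hq Ho Hi.
  by split=> //; rewrite Hq1; case: (ohead _) Hr => [[[]|]|].
- move=> r c m t m1 t' m' /eqP Hr _ IH1 _ IH2 o k Hc cf Hm Hq; rewrite /= in Hc.
  have [Ho Hi] := code_at_head Hc.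
  have [Hm1 Hq1] := step_pop Hm Hq Ho Hi.
  rewrite Hr /= in Hq1.
  have [Hm2 Hq2] := IH1 _ _ (code_at_behead Hc) _ Hm1 Hq1.
  rewrite 2!iterSr addnC iterD.
  exact: IH2 Hc _ Hm2 Hq2.
Qed.

Lemma reg_tape_IO : reg_tape IO = ord0.
Proof. by apply: val_inj; rewrite /= inordK. Qed.

Lemma sm_delta_seek s : sm_delta sm_seek s =
  if s (reg_tape IO) is Some _
  then (sm_seek, act s IO (s (reg_tape IO), MoveRight))
  else (sm_run false 0, idle s).
Proof. by rewrite /sm_delta /sm_seek [val _]inordK. Qed.

Lemma sm_delta_rewind s : sm_delta sm_rewind s =
  if s (reg_tape IO) is Some _
  then (sm_rewind, act s IO (s (reg_tape IO), MoveLeft))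
  else (sm_halt, act s IO (s (reg_tape IO), MoveRight)).
Proof. by rewrite /sm_delta /sm_rewind [val _]inordK. Qed.

Lemma sm_seek_halt : sm_seek != sm_halt.
Proof. by apply/eqP => -[] /(congr1 val); rewrite /= !inordK. Qed.

Lemma sm_rewind_halt : sm_rewind != sm_halt.
Proof. by apply/eqP => -[] /(congr1 val); rewrite /= !inordK. Qed.

(** Walking right over the input makes it a stack with its last symbol on top, whence the reversal;
    the extra step is the one that meets the blank. *)
Lemma seek_input (c : conf) l w :
  cur_state c = sm_seek ->
  cur_tape c (reg_tape IO) = Tape (cells l) (cells w) ->
  (forall r, r <> IO -> holds_stack (cur_tape c (reg_tape r)) [::]) ->
  represents (iter (size w).+1 (@step _ stack_machine) c)
     (Mem (rev w ++ l) [::] [::] [::] [::]) /\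
  cur_state (iter (size w).+1 (@step _ stack_machine) c) = sm_run false 0.
Proof.
elim: w l c => [|a w IH] l c Hq Hio Ho.
  rewrite [iter _ _ _]/= (step_run Hq) ?sm_seek_halt // sm_delta_seek ffunE Hio /=.
  split=> // r; rewrite /= /idle ffunE; apply: holds_stack_idle.
  by case: r; try apply: Ho => //; rewrite Hio.
rewrite iterSr rev_cons cat_rcons; apply: IH.
- by rewrite (step_run Hq) ?sm_seek_halt // sm_delta_seek ffunE Hio.
- rewrite (step_run Hq) ?sm_seek_halt // sm_delta_seek ffunE Hio /=.
  by rewrite /act eqxx Hio.
- move=> r Hr; rewrite (step_run Hq) ?sm_seek_halt // sm_delta_seek ffunE Hio /=.
  rewrite /act; case: eqP => [/reg_tape_inj //|_].
  by rewrite ffunE; apply/holds_stack_idle/Ho.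
Qed.

Lemma rewind_output (c : conf) l r :
  cur_state c = sm_rewind ->
  cur_tape c (reg_tape IO) = Tape (behead (cells l)) (head None (cells l) :: r) ->
  let c' := iter (size l).+1 (@step _ stack_machine) c in
  cur_state c' = sm_halt /\ from_head (cur_tape c' (reg_tape IO)) = cells (rev l) ++ r.
Proof.
elim: l c r => [|b l IH] c r Hq Hio.
  rewrite [iter _ _ _]/= (step_run Hq) ?sm_rewind_halt // sm_delta_rewind ffunE Hio /=; split=> //.
  by rewrite /act eqxx Hio.
rewrite iterSr rev_cons /cells map_rcons cat_rcons; apply: IH.
- by rewrite (step_run Hq) ?sm_rewind_halt // sm_delta_rewind ffunE Hio.
- rewrite (step_run Hq) ?sm_rewind_halt // sm_delta_rewind ffunE Hio /=.
  by rewrite /act eqxx Hio.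
Qed.

Lemma output_cells s r :
  all (pred1 None) r -> output_word (cells s ++ r) = s.
Proof. by elim: s => [|a s IH] /= Hr; [case: r Hr => // b r /andP[/eqP->]|rewrite IH]. Qed.

End StackMachine.

Lemma exec_outputs c w t out m' :
  exec c (Mem (rev w) [::] [::] [::] [::]) t m' -> io m' = rev out ->
  exists M : machine symbol,
    M = stack_machine (compile c 0 (csize c)) /\
    outputs_within M w (size w + size out + t + 3) out.
Proof.
move=> He Hout; set P := compile c 0 (csize c); exists (stack_machine P); split=> //.
have [Hm Hq] : represents (iter (size w).+1 (@step _ (stack_machine P))
     (initial (stack_machine P) w)) (Mem (rev w) [::] [::] [::] [::]) /\
  cur_state (iter (size w).+1 (@step _ (stack_machine P)) (initial (stack_machine P) w))
   = sm_run P false 0.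
  rewrite -[rev w]cats0 -[[::]]/(rev [::]); apply: seek_input => //.
  - by rewrite /= reg_tape_IO.
  - move=> r Hr; rewrite /= ifN //; apply/eqP; rewrite -reg_tape_IO.
    by move/reg_tape_inj.
have Hat : code_at P 0 (compile c 0 (csize c)).
  by exists [::], [::]; rewrite cats0.
have [{}Hm {}Hq] := exec_compile He Hat Hm Hq.
move: Hm Hq; set c1 := iter t _ _ => Hm Hq.
have Hs : size P = csize c by rewrite size_compile.
have Hstep := step_run Hq (sm_run_halt P false (csize c)).
have Hc2 : step c1 = @Config symbol (stack_machine P) (sm_rewind P)
  (fun i => write_move (cur_tape c1 i) (act [ffun i => scanned (cur_tape c1 i)] IO
     ([ffun i => scanned (cur_tape c1 i)] (reg_tape IO), MoveLeft) i)).
  by rewrite Hstep /sm_run /sm_delta inordK ?size_compile // -{1}Hs eqxx.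
have [Hl Hr] := Hm IO.
have := @rewind_output P (step c1) (io m') (None :: behead (from_head (cur_tape c1 (reg_tape IO)))).
rewrite {1}Hc2 => /(_ erefl).
have -> : cur_tape (step c1) (reg_tape IO) = Tape (behead (cells (io m')))
  [:: head None (cells (io m')), None & behead (from_head (cur_tape c1 (reg_tape IO)))].
  rewrite Hc2 /= /act eqxx ffunE (scanned_blank (Hm IO)).
  by case: (cur_tape c1 _) Hl => l r /= ->.
move=> /(_ erefl) [Hh Hf].
(* Read from right to left: seeking the end of the input, running the program, stepping onto the top
   of the output, rewinding. *)
have -> : size w + size out + t + 3 = (size (io m')).+1 + (1 + (t + (size w).+1)).
  by rewrite Hout size_rev; lia.
rewrite /outputs_within iterD (iterD 1) (iterD t) -/c1 -[iter 1 _ c1]/(step c1); split; first by rewrite Hh /= eqxx.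
rewrite -(reg_tape_IO) Hf Hout revK output_cells //=.
exact: all_blank_behead.
Qed.

(** * Binary trees on the main stack *)

Inductive tree := Leaf | Node of tree & tree.

(** Preorder notation is prefix-free, so the tree on top of the main stack delimits itself without a
    separator. *)
Fixpoint word (x : tree) : seq symbol :=
  if x is Node a b then sym1 :: word a ++ word b else [:: sym0].

Definition tsize (x : tree) : nat := size (word x).

Lemma tsize_Node a b : tsize (Node a b) = (tsize a + tsize b).+1.
Proof. by rewrite /tsize /= size_cat. Qed.

Lemma tsize_gt0 x : 0 < tsize x.
Proof. by case: x. Qed.

(* Moves one tree off the main stack, pushing its symbols with [w]; the ones on
   the flag stack count the subtrees still to be read. *)
Definition move_tree (w : symbol -> cmd) : cmd :=
  (Push FS sym0 ;; Push FS sym1 ;;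
   While FS (Case MS Skip (w sym0) (w sym1 ;; Push FS sym1 ;; Push FS sym1) Skip))%cmd.

(** Undoes the reversal caused by [move_tree]. The loop ends at the separator pushed below the saved
    tree, so older contents of [r] survive. *)
Definition restore (r : reg) : cmd :=
  (Push FS sym1 ;;
   While FS (Case r (Push FS sym0) (Push MS sym0 ;; Push FS sym1)
               (Push MS sym1 ;; Push FS sym1) (Push FS sym0)))%cmd.

Lemma exec_eqt c m t t' m' : exec c m t m' -> t = t' -> exec c m t' m'.
Proof. by move=> + <-. Qed.

Section MoveTree.
Variables (w : symbol -> cmd) (k : nat).
Variables (ra rb : seq symbol -> seq symbol -> seq symbol).
Hypothesis Hw : forall a i m sa sb s f,
  exec (w a) (Mem i m (ra s sa) (rb s sb) f) k (Mem i m (ra (a :: s) sa) (rb (a :: s) sb) f).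

Let body := Case MS Skip (w sym0) (w sym1 ;; Push FS sym1 ;; Push FS sym1)%cmd Skip.

(** The statement goes backwards: a run of the loop after the tree is consumed is extended to a run
    before it, with one more pending 1 on [FS]. Hence the right subtree is treated first in the
    induction. [ra] and [rb] are the effect of [w] on the scratch stacks: prepending the symbols
    read, or ignoring them. *)
Lemma exec_move_loop x i m a b s f t m' :
  exec (While FS body)
    (Mem i m (ra (rev (word x) ++ s) a) (rb (rev (word x) ++ s) b) f) t m' ->
  exists2 t', t' <= (k + 6) * tsize x + t &
  exec (While FS body) (Mem i (word x ++ m) (ra s a) (rb s b) (sym1 :: f)) t' m'.
Proof.
elim: x i m s f t m' => [|x IHx y IHy] i m s f t m' H.
  exists (2 + (k.+2 + t)); first by rewrite /tsize /=; lia.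
  apply: ExecLoop => //=; last exact: H.
  by apply: ExecCase => /=; apply: Hw.
rewrite /= rev_cons cat_rcons rev_cat -catA in H.
have [t1 Ht1 H1] := IHy _ _ _ _ _ _ H.
have [t2 Ht2 H2] := IHx _ _ _ _ _ _ H1.
exists (2 + ((k + (1 + 1)).+2 + t2)); first by rewrite tsize_Node; lia.
apply: ExecLoop => //=; last by rewrite catA in H2; exact: H2.
apply: ExecCase => /=; rewrite /pop /=; apply: ExecSeq; first exact: Hw.
by apply: ExecSeq; exact: ExecPush.
Qed.

Lemma exec_move_tree x i m a b f :
  exists2 t, t <= (k + 6) * tsize x + 4 &
  exec (move_tree w) (Mem i (word x ++ m) (ra [::] a) (rb [::] b) f) t
    (Mem i m (ra (rev (word x)) a) (rb (rev (word x)) b) f).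
Proof.
have H : exec (While FS body)
    (Mem i m (ra (rev (word x) ++ [::]) a) (rb (rev (word x) ++ [::]) b) (sym0 :: f)) 2
    (Mem i m (ra (rev (word x)) a) (rb (rev (word x)) b) f).
  by rewrite cats0; apply: ExecStop.
have [t Ht {}H] := exec_move_loop H.
exists (1 + (1 + t)); first by lia.
apply: ExecSeq; first exact: ExecPush.
by apply: ExecSeq; first exact: ExecPush.
Qed.

End MoveTree.

Definition bit (a : symbol) : bool := a != None.

Lemma word_bits x : all bit (word x).
Proof. by elim: x => //= x IHx y IHy; rewrite all_cat IHx IHy. Qed.

Lemma exec_restoreA s i m a b f : all bit s ->
  exec (restore SA) (Mem i m (s ++ symH :: a) b f) (6 * size s + 8)
    (Mem i (rev s ++ m) a b f).
Proof.
move=> Hs; apply: (@exec_eqt _ _ (1 + (6 * size s + 7))); last by lia.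
apply: ExecSeq; first exact: ExecPush.
rewrite /push /=; elim: s m Hs => [|c s IH] m /=.
  move=> _; apply: (@exec_eqt _ _ (2 + (1.+2 + 2))) => //.
  apply: ExecLoop => //=; first by apply: ExecCase; apply: ExecPush.
  exact: ExecStop.
case/andP=> Hc Hs; rewrite rev_cons cat_rcons.
apply: (@exec_eqt _ _ (2 + ((1 + 1).+2 + (6 * size s + 7)))); last by rewrite mulnS -!addnA.
apply: (@ExecLoop _ _ _ _ (Mem i (c :: m) (s ++ symH :: a) b (sym1 :: f)) _ _) => //=; last exact: IH.
apply: ExecCase => /=.
by case: c Hc => [[]|] //= _; (apply: ExecSeq; first exact: ExecPush); exact: ExecPush.
Qed.

Lemma exec_restoreB s i m a b f : all bit s ->
  exec (restore SB) (Mem i m a (s ++ symH :: b) f) (6 * size s + 8)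
    (Mem i (rev s ++ m) a b f).
Proof.
move=> Hs; apply: (@exec_eqt _ _ (1 + (6 * size s + 7))); last by lia.
apply: ExecSeq; first exact: ExecPush.
rewrite /push /=; elim: s m Hs => [|c s IH] m /=.
  move=> _; apply: (@exec_eqt _ _ (2 + (1.+2 + 2))) => //.
  apply: ExecLoop => //=; first by apply: ExecCase; apply: ExecPush.
  exact: ExecStop.
case/andP=> Hc Hs; rewrite rev_cons cat_rcons.
apply: (@exec_eqt _ _ (2 + ((1 + 1).+2 + (6 * size s + 7)))); last by rewrite mulnS -!addnA.
apply: (@ExecLoop _ _ _ _ (Mem i (c :: m) a (s ++ symH :: b) (sym1 :: f)) _ _) => //=; last exact: IH.
apply: ExecCase => /=.
by case: c Hc => [[]|] //= _; (apply: ExecSeq; first exact: ExecPush); exact: ExecPush.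
Qed.

(** Quantifying over everything below [s] and over the other stacks lets a program verified on its
    own argument run on top of any pending data. *)
Definition run (c : cmd) (s : seq symbol) (t : nat) (s' : seq symbol) : Prop :=
  forall i m a b f, exists2 u, u <= t &
    exec c (Mem i (s ++ m) a b f) u (Mem i (s' ++ m) a b f).

Lemma run_seq c d s1 t1 s2 t2 s3 :
  run c s1 t1 s2 -> run d s2 t2 s3 -> run (Seq c d) s1 (t1 + t2) s3.
Proof.
move=> H1 H2 i m a b f.
have [u1 Hu1 E1] := H1 i m a b f; have [u2 Hu2 E2] := H2 i m a b f.
by exists (u1 + u2); [lia | apply: ExecSeq E1 E2].
Qed.

Lemma run_leq c s t t' s' : run c s t s' -> t <= t' -> run c s t' s'.
Proof.
by move=> H le i m a b f; have [u Hu E] := H i m a b f; exists u => //; lia.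
Qed.

Lemma run_frame c s t s' r : run c s t s' -> run c (s ++ r) t (s' ++ r).
Proof.
by move=> H i m a b f; have [u Hu E] := H i (r ++ m) a b f; exists u; rewrite // -!catA.
Qed.

Lemma run_size c s t s' : run c s t s' -> size s' <= size s + t.
Proof.
move=> /(_ [::] [::] [::] [::] [::]) [u Hu E].
by have := exec_size MS E; rewrite /= !cats0; lia.
Qed.

Definition drop_tree : cmd := move_tree (fun=> Skip).

Lemma run_drop x : run drop_tree (word x) (7 * tsize x + 4) [::].
Proof.
move=> i m a b f.
have [] := @exec_move_tree (fun=> Skip) 1 (fun _ s => s) (fun _ s => s) _ x i m a b f.
  by move=> *; apply: ExecSkip.
by move=> t Ht H; exists t => //; lia.
Qed.

Definition dup_tree : cmd :=
  (Push SA symH ;; Push SB symH ;;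
   move_tree (fun a => Push SA a ;; Push SB a) ;; restore SA ;; restore SB)%cmd.

Lemma run_dup x : run dup_tree (word x) (20 * tsize x + 22) (word x ++ word x).
Proof.
move=> i m a b f.
have [] := @exec_move_tree (fun a => Push SA a ;; Push SB a)%cmd 2
  (fun s a => s ++ a) (fun s b => s ++ b) _ x i m (symH :: a) (symH :: b) f.
  by move=> *; apply: (@ExecSeq _ _ _ 1 _ 1); apply: ExecPush.
move=> t Ht H; exists (1 + (1 + (t + ((6 * tsize x + 8) + (6 * tsize x + 8))))).
  by lia.
apply: ExecSeq; first exact: ExecPush.
apply: ExecSeq; first exact: ExecPush.
apply: ExecSeq; first exact: H.
have Hb : all bit (rev (word x)) by rewrite all_rev word_bits.
apply: ExecSeq; rewrite /tsize -(size_rev (word x)); first exact: exec_restoreA.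
by have := exec_restoreB i (rev (rev (word x)) ++ m) a b f Hb; rewrite !revK catA.
Qed.

Definition swap_tree : cmd :=
  (Push SA symH ;; move_tree (Push SA) ;;
   Push SB symH ;; move_tree (Push SB) ;; restore SA ;; restore SB)%cmd.

Lemma run_swap x y :
  run swap_tree (word x ++ word y) (20 * (tsize x + tsize y) + 30) (word y ++ word x).
Proof.
move=> i m a b f.
have [] := @exec_move_tree (Push SA) 1
  (fun s a => s ++ a) (fun _ b => b) _ x i (word y ++ m) (symH :: a) b f.
  by move=> *; apply: ExecPush.
move=> t1 Ht1 H1.
have [] := @exec_move_tree (Push SB) 1 (fun _ a => a)
  (fun s a => s ++ a) _ y i m (rev (word x) ++ symH :: a) (symH :: b) f.
  by move=> *; apply: ExecPush.
move=> t2 Ht2 H2.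
exists (1 + (t1 + (1 + (t2 + ((6 * tsize x + 8) + (6 * tsize y + 8)))))).
  by lia.
apply: ExecSeq; first exact: ExecPush.
apply: ExecSeq; first by rewrite /= -catA; exact: H1.
apply: ExecSeq; first exact: ExecPush.
apply: ExecSeq; first exact: H2.
have Hx : all bit (rev (word x)) by rewrite all_rev word_bits.
have Hy : all bit (rev (word y)) by rewrite all_rev word_bits.
apply: ExecSeq; rewrite /tsize -(size_rev (word _)); first exact: exec_restoreA.
by have := exec_restoreB i (rev (rev (word x)) ++ m) a b f Hy; rewrite !revK catA.
Qed.

Lemma run_push a : run (Push MS a) [::] 1 [:: a].
Proof. by move=> i m x b f; exists 1 => //; apply: ExecPush. Qed.

Lemma run_case a s ce c0 c1 ch t s' :
  run (branch (Some a) ce c0 c1 ch) s t s' -> run (Case MS ce c0 c1 ch) (a :: s) t.+2 s'.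
Proof.
move=> H i m x b f; have [u Hu E] := H i m x b f.
by exists u.+2 => //; apply: ExecCase.
Qed.

(* The flag pushed tells whether the first component of the top tree is a node. *)
Definition test_tree : cmd :=
  Case MS Skip
    (Push MS sym0 ;; Push FS sym0)
    (Case MS Skip
       (Push MS sym0 ;; Push MS sym1 ;; Push FS sym0)
       (Push MS sym1 ;; Push MS sym1 ;; Push FS sym1) Skip) Skip.

Definition while_tree (c : cmd) : cmd :=
  (test_tree ;; While FS (c ;; test_tree))%cmd.

(** Loop states are pairs whose first component is the list of items still to be processed; the loop
    goes on while this list is nonempty. *)
Definition more (x : tree) : bool := if x is Node (Node _ _) _ then true else false.

Lemma exec_test x i m a b f : exists2 t, t <= 7 &
  exec test_tree (Mem i (word x ++ m) a b f) t
     (Mem i (word x ++ m) a b (Some (more x) :: f)).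
Proof.
case: x => [|[|x y] z] /=.
- exists (1 + 1).+2 => //; apply: ExecCase; apply: ExecSeq; exact: ExecPush.
- exists (1 + (1 + 1)).+4 => //; do 2!apply: ExecCase => /=.
  by do 2!(apply: ExecSeq; first exact: ExecPush); exact: ExecPush.
- exists (1 + (1 + 1)).+4 => //; do 2!apply: ExecCase => /=.
  by do 2!(apply: ExecSeq; first exact: ExecPush); exact: ExecPush.
Qed.

Lemma run_while c (x : nat -> tree) n T :
  (forall j, j < n -> more (x j)) -> ~~ more (x n) ->
  (forall j, j < n -> run c (word (x j)) T (word (x j.+1))) ->
  run (while_tree c) (word (x 0)) (n * (T + 9) + 9) (word (x n)).
Proof.
move=> Hm Hn Hr i m a b f.
have [t Ht E] := exec_test (x 0) i m a b f.
suff [t' Ht' E'] : exists2 t', t' <= n * (T + 9) + 2 &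
   exec (While FS (c ;; test_tree)%cmd) (Mem i (word (x 0) ++ m) a b (Some (more (x 0)) :: f)) t'
     (Mem i (word (x n) ++ m) a b f).
  by exists (t + t'); [lia | apply: ExecSeq E E'].
clear t Ht E; elim: n x Hm Hn Hr => [|n IH] x Hm Hn Hr.
  by exists 2 => //; apply: ExecStop; rewrite /= (negPf Hn).
have [t' Ht' E'] := IH (fun j => x j.+1) (fun j => Hm j.+1) Hn (fun j => Hr j.+1).
have [t1 Ht1 E1] := Hr 0 isT i m a b f.
have [t2 Ht2 E2] := exec_test (x 1) i m a b f.
exists (2 + ((t1 + t2) + t')); first by lia.
have H0 := Hm 0 isT.
apply: ExecLoop; first by rewrite /= H0.
  by rewrite /pop /=; apply: ExecSeq E1 E2.
exact: E'.
Qed.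

(** * Polynomial time functions *)

Class Code (T : Type) := code : T -> tree.
#[global] Hint Mode Code ! : typeclass_instances.

#[global] Instance code_unit : Code unit := fun=> Leaf.
#[global] Instance code_prod A B `{Code A} `{Code B} : Code (A * B) :=
  fun p => Node (code p.1) (code p.2).
#[global] Instance code_seq A `{Code A} : Code (seq A) :=
  foldr (fun a l => Node (code a) l) Leaf.
(** Unary, so that bounding a number bounds its code. Binary notation occurs only in the words read
    and written by the machine. *)
#[global] Instance code_nat : Code nat := fun n => iter n (Node Leaf) Leaf.
#[global] Instance code_bool : Code bool := fun b => code (nat_of_bool b).

Definition csz (T : Type) `{Code T} (x : T) : nat := tsize (code x).

Definition FP (X Y : Type) `{Code X} `{Code Y} (f : X -> Y) : Prop :=
  exists c d, forall x, run c (word (code x)) ((csz x + 2) ^ d) (word (code (f x))).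

(* Bases at least 2 absorb constants into the exponent. *)
Definition poly_bounded (T : nat -> nat) : Prop := exists d, forall n, T n <= (n + 2) ^ d.

Lemma pow_le n d d' : d <= d' -> (n + 2) ^ d <= (n + 2) ^ d'.
Proof. by move=> H; rewrite leq_exp2l //; lia. Qed.

Lemma pow_mono m n d : m <= n -> (m + 2) ^ d <= (n + 2) ^ d.
Proof. by case: d => // d H; rewrite leq_exp2r //; lia. Qed.

Lemma polyb_le T T' : poly_bounded T -> (forall n, T' n <= T n) -> poly_bounded T'.
Proof. by case=> d H H'; exists d => n; apply: leq_trans (H' n) (H n). Qed.

Lemma polyb_const k : poly_bounded (fun=> k).
Proof.
exists k => n; apply: leq_trans (ltnW (ltn_expl k (isT : 1 < 2))) _.
by case: k => // k; rewrite leq_exp2r //; lia.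
Qed.

Lemma polyb_id : poly_bounded id.
Proof. by exists 1 => n; rewrite expn1; lia. Qed.

Lemma polyb_pow d : poly_bounded (fun n => (n + 2) ^ d).
Proof. by exists d. Qed.

Lemma polyb_add S T :
  poly_bounded S -> poly_bounded T -> poly_bounded (fun n => S n + T n).
Proof.
move=> [c Hc] [d Hd]; exists (c + d).+1 => n.
have := Hc n; have := Hd n.
have := @pow_le n c (c + d) (leq_addr _ _); have := @pow_le n d (c + d) (leq_addl _ _).
have : 2 * (n + 2) ^ (c + d) <= (n + 2) ^ (c + d).+1.
  by rewrite expnS leq_mul2r; apply/orP; right; lia.
by lia.
Qed.

Lemma polyb_mul S T :
  poly_bounded S -> poly_bounded T -> poly_bounded (fun n => S n * T n).
Proof.
by move=> [c Hc] [d Hd]; exists (c + d) => n; rewrite expnD leq_mul.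
Qed.

Lemma polyb_comp S T :
  poly_bounded S -> poly_bounded T -> poly_bounded (fun n => S (T n)).
Proof.
move=> [c Hc] [d Hd].
have [e He] := polyb_add (polyb_const 2) (ex_intro _ d Hd).
exists (e * c) => n; apply: leq_trans (Hc _) _.
rewrite expnM; case: c {Hc} => // c.
by rewrite leq_exp2r //; have := He n; lia.
Qed.


Ltac polyb := repeat first [exact: polyb_id | exact: polyb_pow | exact: polyb_const
  | apply: polyb_add | apply: polyb_mul | assumption].

Lemma FPI X Y `{Code X} `{Code Y} (f : X -> Y) c T : poly_bounded T ->
  (forall x, run c (word (code x)) (T (csz x)) (word (code (f x)))) -> FP f.
Proof. by move=> [d Hd] Hr; exists c, d => x; apply: run_leq (Hr x) (Hd _). Qed.

Lemma run_const s : exists c t, run c [::] t s.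
Proof.
elim: s => [|a s [c [t Hc]]].
  by exists Skip, 1 => i m a b f; exists 1 => //; apply: ExecSkip.
by exists (Seq c (Push MS a)), (t + 1); apply: run_seq Hc (run_frame s (run_push a)).
Qed.

Lemma run_pair (c d : cmd) x y z t1 t2 :
  run c (word x) t1 (word y) -> run d (word x) t2 (word z) ->
  run (dup_tree ;; d ;; swap_tree ;; c ;; Push MS sym1)%cmd (word x)
   (20 * tsize x + 22 + (t2 + (20 * (tsize z + tsize x) + 30 + (t1 + 1)))) (word (Node y z)).
Proof.
move=> Hc Hd.
apply: run_seq (run_dup _) _.
apply: run_seq (run_frame (word x) Hd) _.
apply: run_seq (run_swap _ _) _.
apply: run_seq (run_frame (word z) Hc) _.
exact: (run_frame (word y ++ word z) (run_push sym1)).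
Qed.

(* Branches on the first component [n] of a pair, with [Node x n] passed on
   when it is a node and [x] otherwise. *)
Definition case_tree (cl cn : cmd) : cmd :=
  Case MS Skip Skip
    (Case MS Skip cl (Push MS sym1 ;; swap_tree ;; Push MS sym1 ;; cn) Skip) Skip.

Lemma run_case_tree cl cn n x t s :
  (if n is Node _ _ then run cn (word (Node x n)) t s else run cl (word x) t s) ->
  run (case_tree cl cn) (word (Node n x)) (20 * (tsize n + tsize x) + 36 + t) s.
Proof.
case: n => [|a b] Hn.
  apply: (@run_leq _ _ t.+4); last by lia.
  by apply: run_case => /=; apply: run_case.
apply: (@run_leq _ _
  (1 + (20 * (tsize (Node a b) + tsize x) + 30 + (1 + t))).+4); last by lia.
apply: run_case => /=; apply: run_case => /=.
apply: run_seq; first exact: (run_frame ((word a ++ word b) ++ word x) (run_push sym1)).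
apply: run_seq; first exact: (run_swap (Node a b) x).
apply: run_seq; first exact: (run_frame (word x ++ word (Node a b)) (run_push sym1)).
exact: Hn.
Qed.

Lemma csz_pair A B `{Code A} `{Code B} (a : A) (b : B) :
  csz (a, b) = (csz a + csz b).+1.
Proof. by rewrite /csz /code /code_prod tsize_Node. Qed.

Lemma csz_cons A `{Code A} (a : A) s : csz (a :: s) = (csz a + csz s).+1.
Proof. by rewrite /csz /code /code_seq /= tsize_Node. Qed.

Section Closure.
Context {X Y Z A B : Type} `{Code X} `{Code Y} `{Code Z} `{Code A} `{Code B}.

(** Only codes matter to the machine. This identifies a cons cell with a pair, a boolean with 0 or
    1, and a number with a list of units. *)
Lemma FP_recode (f : X -> Y) (g : X -> Z) :
  (forall x, code (f x) = code (g x)) -> FP f -> FP g.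
Proof. by move=> E [c [d Hf]]; exists c, d => x; rewrite -E. Qed.

Lemma eq_FP (f g : X -> Y) : f =1 g -> FP f -> FP g.
Proof. by move=> E [c [d Hf]]; exists c, d => x; rewrite -E. Qed.

Lemma FP_size (f : X -> Y) : FP f ->
  exists2 T, poly_bounded T & forall x, csz (f x) <= T (csz x).
Proof.
case=> c [d Hf]; exists (fun n => n + (n + 2) ^ d); first by polyb.
by move=> x; apply: run_size (Hf x).
Qed.

Lemma FP_comp (f : Y -> Z) (g : X -> Y) : FP f -> FP g -> FP (fun x => f (g x)).
Proof.
move=> [c [d Hf]] [c' [d' Hg]].
apply: (@FPI _ _ _ _ _ (Seq c' c) (fun n => (n + 2) ^ d' + (n + (n + 2) ^ d' + 2) ^ d)).
  apply: polyb_add; first exact: polyb_pow.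
  by apply: (polyb_comp (polyb_pow d)); polyb.
move=> x; apply: run_seq (Hg x) _; apply: run_leq (Hf _) _.
by apply: pow_mono; apply: run_size (Hg x).
Qed.

Lemma FP_id : FP (fun x : X => x).
Proof.
apply: (@FPI _ _ _ _ _ Skip (fun=> 1)); first exact: polyb_const.
by move=> x i m a b f; exists 1 => //; apply: ExecSkip.
Qed.

Lemma FP_const (k : Y) : FP (fun _ : X => k).
Proof.
have [c [t Hc]] := run_const (word (code k)).
apply: (@FPI _ _ _ _ _ (Seq drop_tree c) (fun n => 7 * n + 4 + t)); first by polyb.
by move=> x; apply: run_seq (run_drop _) Hc.
Qed.

Lemma FP_pair (f : X -> Y) (g : X -> Z) : FP f -> FP g -> FP (fun x => (f x, g x)).
Proof.
move=> [c [d Hf]] [c' [d' Hg]].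
apply: (@FPI _ _ _ _ _ (dup_tree ;; c' ;; swap_tree ;; c ;; Push MS sym1)%cmd
  (fun n => 20 * n + 22 + ((n + 2) ^ d' + (20 * (n + (n + 2) ^ d' + n) + 30 + ((n + 2) ^ d + 1))))).
  by polyb.
move=> x; apply: run_leq (run_pair (Hf x) (Hg x)) _.
by have := run_size (Hg x); rewrite /csz -!/(tsize _); lia.
Qed.

Lemma FP_proj1 : FP (fun p : A * B => p.1).
Proof.
apply: (@FPI _ _ _ _ _ (Case MS Skip Skip (swap_tree ;; drop_tree)%cmd Skip)
   (fun n => 27 * n + 40)).
  by polyb.
case=> x y; apply: (@run_leq _ _ _.+2).
  apply: run_case => /=.
  exact: run_seq (run_swap _ _) (run_frame (word (code x)) (run_drop _)).
by rewrite csz_pair /csz /code; lia.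
Qed.

Lemma FP_proj2 : FP (fun p : A * B => p.2).
Proof.
apply: (@FPI _ _ _ _ _ (Case MS Skip Skip drop_tree Skip) (fun n => 27 * n + 40)).
  by polyb.
case=> x y; apply: (@run_leq _ _ _.+2).
  by apply: run_case => /=; exact: (run_frame (word (code y)) (run_drop _)).
by rewrite csz_pair /csz /code; lia.
Qed.

End Closure.

Lemma FP_app2 X A B C `{Code X} `{Code A} `{Code B} `{Code C} (f : A -> B -> C)
    (a : X -> A) (b : X -> B) :
  FP (fun p : A * B => f p.1 p.2) -> FP a -> FP b -> FP (fun x => f (a x) (b x)).
Proof. by move=> Hf Ha Hb; exact: (FP_comp Hf (FP_pair Ha Hb)). Qed.

Lemma FP_app3 X A B C D `{Code X} `{Code A} `{Code B} `{Code C} `{Code D}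
    (f : A -> B -> C -> D) (a : X -> A) (b : X -> B) (c : X -> C) :
  FP (fun p : A * B * C => f p.1.1 p.1.2 p.2) ->
  FP a -> FP b -> FP c -> FP (fun x => f (a x) (b x) (c x)).
Proof. by move=> Hf Ha Hb Hc; exact: (FP_comp Hf (FP_pair (FP_pair Ha Hb) Hc)). Qed.

Lemma FP_fst X A B `{Code X} `{Code A} `{Code B} (f : X -> A * B) :
  FP f -> FP (fun x => (f x).1).
Proof. exact: (FP_comp FP_proj1). Qed.

Lemma FP_snd X A B `{Code X} `{Code A} `{Code B} (f : X -> A * B) :
  FP f -> FP (fun x => (f x).2).
Proof. exact: (FP_comp FP_proj2). Qed.

Section ListClosure.
Context {X Y A : Type} `{Code X} `{Code Y} `{Code A}.

Lemma FP_cons (f : X -> A) (g : X -> seq A) :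
  FP f -> FP g -> FP (fun x => f x :: g x).
Proof. by move=> Hf Hg; apply: FP_recode (FP_pair Hf Hg). Qed.

Lemma FP_case (l : X -> seq A) (f : X -> Y) (g : X -> A -> seq A -> Y) :
  FP l -> FP f -> FP (fun p : X * (A * seq A) => g p.1 p.2.1 p.2.2) ->
  FP (fun x => if l x is a :: s then g x a s else f x).
Proof.
move=> [cl [dl Hl]] [c [d Hf]] [c' [d' Hg]].
apply: (@FPI _ _ _ _ _ ((dup_tree ;; Skip ;; swap_tree ;; cl ;; Push MS sym1) ;; case_tree c c')%cmd
  (fun n => (20 * n + 22 + (1 + (20 * (n + n) + 30 + ((n + 2) ^ dl + 1)))) +
    (20 * ((n + (n + 2) ^ dl) + n) + 36 +
      ((n + 2) ^ d + (((n + 1 + (n + (n + 2) ^ dl))) + 2) ^ d')))).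
  have Hp : poly_bounded (fun n => (((n + 1 + (n + (n + 2) ^ dl))) + 2) ^ d').
    by apply: (polyb_comp (polyb_pow d')); polyb.
  by polyb.
move=> x; have Hsk : run Skip (word (code x)) 1 (word (code x)).
  by move=> i m a b h; exists 1 => //; apply: ExecSkip.
have Hsz : csz (l x) <= csz x + (csz x + 2) ^ dl by apply: run_size (Hl x).
apply: run_seq; first exact: run_pair (Hl x) Hsk.
apply: run_leq.
  apply: (@run_case_tree _ _ _ _ ((csz x + 2) ^ d + ((csz x + 1 + csz (l x)) + 2) ^ d')).
  case: (l x) => [|a s] /=.
    by apply: run_leq (Hf x) _; lia.
  apply: run_leq (Hg (x, (a, s))) _.
  have -> : csz (x, (a, s)) = csz x + 1 + csz (a :: s).
    by rewrite !csz_pair csz_cons; lia.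
  by lia.
apply: leq_add; last first.
  rewrite leq_add2l; apply: pow_mono; lia.
by move: Hsz; rewrite /csz; lia.
Qed.

(** The loop stops by itself when [more] fails, and [n] counts its rounds. The bound [S] on all
    intermediate states is essential: iterating a polynomial time map, such as doubling, can
    otherwise grow exponentially. *)
Lemma FP_loop (init : X -> Y) (f : Y -> Y) (n : X -> nat) N S :
  FP init -> FP f -> poly_bounded N -> poly_bounded S ->
  (forall x, n x <= N (csz x)) ->
  (forall x j, j < n x -> more (code (iter j f (init x)))) ->
  (forall x, ~~ more (code (iter (n x) f (init x)))) ->
  (forall x j, j <= n x -> csz (iter j f (init x)) <= S (csz x)) ->
  FP (fun x => iter (n x) f (init x)).
Proof.
move=> [ci [di Hi]] [c [d Hf]] HN HS Hn Hmore Hstop Hsize.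
apply: (@FPI _ _ _ _ _ (Seq ci (while_tree c))
   (fun k => (k + 2) ^ di + (N k * ((S k + 2) ^ d + 9) + 9))).
  have HSd := polyb_comp (polyb_pow d) HS.
  by polyb.
move=> x; apply: run_seq (Hi x) _.
apply: (@run_leq _ _ (n x * ((S (csz x) + 2) ^ d + 9) + 9)).
  apply: (@run_while c (fun j => code (iter j f (init x)))) => // [j|j Hj]; first exact: Hmore.
  by apply: run_leq (Hf _) _; apply: pow_mono; apply: Hsize; exact: ltnW.
by rewrite leq_add2r leq_mul2r Hn orbT.
Qed.

End ListClosure.

Lemma csz_nil A `{Code A} : csz (@nil A) = 1.
Proof. by []. Qed.

Lemma csz_gt0 A `{Code A} (a : A) : 0 < csz a.
Proof. exact: tsize_gt0. Qed.

Lemma csz_nat (n : nat) : csz n = n.*2.+1.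
Proof. by elim: n => // n IH; rewrite -[csz n.+1]/(tsize (Node Leaf (code n))) tsize_Node -/(csz n) IH doubleS. Qed.

Lemma size_csz A `{Code A} (s : seq A) : size s < csz s.
Proof. by elim: s => //= a s IH; rewrite csz_cons; lia. Qed.

Lemma csz_mem_nth A `{Code A} (s : seq A) a j : j < size s -> csz (nth a s j) <= csz s.
Proof.
elim: s j => //= b s IH [|j] Hj; rewrite csz_cons /=; first by lia.
by have := IH _ Hj; lia.
Qed.

Lemma csz_drop A `{Code A} (s : seq A) j : csz (drop j s) <= csz s.
Proof.
elim: s j => [|b s IH] [|j] //=; rewrite csz_cons.
by have := IH j; lia.
Qed.

Lemma FP_foldl X S A `{Code X} `{Code S} `{Code A}
    (f : X -> S -> A -> S) (l : X -> seq A) (s : X -> S) T :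
  FP l -> FP s -> FP (fun p : X * S * A => f p.1.1 p.1.2 p.2) ->
  poly_bounded T ->
  (forall x j, csz (foldl (f x) (s x) (take j (l x))) <= T (csz x)) ->
  FP (fun x => foldl (f x) (s x) (l x)).
Proof.
move=> Hl Hs Hf HT Hsz.
(* The unread items come first, where the loop test looks; the parameter [x] is carried along for
   [f]. *)
pose init x := (l x, (s x, x)).
pose g (y : seq A * (S * X)) :=
  if y.1 is a :: r then (r, (f y.2.2 y.2.1 a, y.2.2)) else y.
have Hinit : FP init by apply: FP_pair Hl (FP_pair Hs FP_id).
have Hg : FP g.
  apply: (FP_case FP_proj1 FP_id); apply: FP_pair.
    by apply: FP_snd; exact: FP_proj2.
  have F2 : FP (fun x : seq A * (S * X) * (A * seq A) => x.1.2).
    by apply: FP_snd; exact: FP_proj1.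
  apply: FP_pair; last exact: FP_snd.
  apply: (FP_app3 Hf); [exact: FP_snd | exact: FP_fst |].
  by apply: FP_fst; exact: FP_proj2.
have E x j : j <= size (l x) ->
    iter j g (init x) = (drop j (l x), (foldl (f x) (s x) (take j (l x)), x)).
  elim: j => [|j IH] Hj; first by rewrite drop0 take0.
  rewrite iterS (IH (ltnW Hj)) /g /=.
  case El : (l x) Hj => [//|a0 r] Hj; rewrite -El in Hj *.
  by rewrite (drop_nth a0 Hj) (take_nth a0 Hj) foldl_rcons.
have [Tl HTl Hlsz] := FP_size Hl.
have F : FP (fun x => iter (size (l x)) g (init x)).
  apply: (@FP_loop _ _ _ _ init g _ Tl (fun n => (Tl n + (T n + n).+1).+1)) => //.
  - apply: (@polyb_le (fun n => (Tl n + (T n + n + 1)) + 1)); first by polyb.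
    by move=> n; lia.
  - by move=> x; apply: leq_trans (Hlsz x); apply/ltnW/size_csz.
  - move=> x j Hj; rewrite (E _ _ (ltnW Hj)).
    by case: (l x) Hj => // a r Hj; rewrite (drop_nth a Hj).
  - by move=> x; rewrite E // drop_size.
  - move=> x j Hj; rewrite E // !csz_pair.
    rewrite !ltnS leq_add ?leq_add //; first exact: leq_trans (csz_drop _ _) (Hlsz x).
    by rewrite ltnS leq_add.
have := FP_comp FP_proj1 (FP_comp FP_proj2 F); apply: eq_FP => x.
by rewrite E // take_size.
Qed.

Section Basic.
Context {X A : Type} `{Code X} `{Code A}.

Lemma FP_succ (f : X -> nat) : FP f -> FP (fun x => (f x).+1).
Proof. by move=> Hf; apply: (FP_recode _ (FP_pair (FP_const tt) Hf)). Qed.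

Lemma code_nseq n : code (nseq n tt) = code n.
Proof. by elim: n => //= n IH; rewrite -[code n.+1]/(Node Leaf (code n)) -IH. Qed.

Lemma FP_nseq (f : X -> nat) : FP f -> FP (fun x => nseq (f x) tt).
Proof. by apply: FP_recode => x; rewrite code_nseq. Qed.

Lemma FP_pred (f : X -> nat) : FP f -> FP (fun x => (f x).-1).
Proof.
move=> Hf; have {}Hf : FP (fun x => nseq (f x) tt).
  by apply: FP_recode Hf => x; rewrite code_nseq.
apply: (@FP_recode _ (seq unit) _ _ _ _ (fun x => if nseq (f x) tt is a :: s then s else [::])).
  by move=> x; case: (f x) => //= n; rewrite code_nseq.
apply: (FP_case Hf (FP_const _)).
by apply: FP_snd; exact: FP_proj2.
Qed.

Lemma FP_if (b : X -> bool) (f g : X -> A) : FP b -> FP f -> FP g ->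
  FP (fun x => if b x then f x else g x).
Proof.
move=> Hb Hf Hg.
have Hn : FP (fun x => nseq (nat_of_bool (b x)) tt).
  by apply: FP_recode Hb => x; rewrite code_nseq.
have F : FP (fun p : X * (unit * seq unit) => f p.1) by apply: (FP_comp Hf FP_proj1).
have := FP_case (g := fun x _ _ => f x) Hn Hg F.
by apply: eq_FP => x; case: (b x).
Qed.

Lemma FP_nat_of_bool (b : X -> bool) : FP b -> FP (fun x => nat_of_bool (b x)).
Proof. exact: FP_recode. Qed.

Lemma FP_head (a : X -> A) (l : X -> seq A) :
  FP a -> FP l -> FP (fun x => head (a x) (l x)).
Proof.
move=> Ha Hl; apply: (FP_case Hl Ha).
by apply: FP_fst; exact: FP_proj2.
Qed.

Lemma FP_behead (l : X -> seq A) : FP l -> FP (fun x => behead (l x)).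
Proof.
move=> Hl; apply: (@eq_FP _ _ _ _ (fun x => if l x is a :: s then s else [::])).
  by move=> x; case: (l x).
apply: (FP_case Hl (FP_const _)).
by apply: FP_snd; exact: FP_proj2.
Qed.

End Basic.

(** The growth of the accumulator in one step depends on the parameter and the item but not on the
    accumulator, so it adds up to a polynomial. *)
Lemma FP_foldl_growth X S A `{Code X} `{Code S} `{Code A}
    (f : X -> S -> A -> S) (l : X -> seq A) (s : X -> S) T :
  FP l -> FP s -> FP (fun p : X * S * A => f p.1.1 p.1.2 p.2) ->
  poly_bounded T ->
  (forall x s a, csz (f x s a) <= csz s + T (csz x + csz a)) ->
  FP (fun x => foldl (f x) (s x) (l x)).
Proof.
move=> Hl Hs Hf [d Hd] Hg.
have [Tl HTl Hlsz] := FP_size Hl; have [Ts HTs Hssz] := FP_size Hs.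
apply: (@FP_foldl _ _ _ _ _ _ _ _ _ (fun n => Ts n + Tl n * (n + Tl n + 2) ^ d)) => //.
  have Hc : poly_bounded (fun n => (n + Tl n + 2) ^ d).
    by apply: (polyb_comp (polyb_pow d)); polyb.
  by polyb.
move=> x j.
have Hj : csz (foldl (f x) (s x) (take j (l x))) <=
    csz (s x) + size (take j (l x)) * (csz x + Tl (csz x) + 2) ^ d.
  elim: j => [|j IH]; first by rewrite take0 /=; lia.
  have [Hj|Hj] := ltnP j (size (l x)); last first.
    by rewrite take_oversize in IH => //; rewrite take_oversize //; apply: leqW.
  case E : (l x) Hj => [//|a0 r] Hj; rewrite -E in Hj *.
  rewrite (take_nth a0 Hj) foldl_rcons size_rcons.
  apply: leq_trans (Hg _ _ _) _.
  rewrite mulSn addnCA addnC; apply: leq_add IH.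
  apply: leq_trans (Hd _) _; apply: pow_mono; rewrite leq_add2l.
  exact: leq_trans (csz_mem_nth a0 Hj) (Hlsz x).
apply: leq_trans Hj _; apply: leq_add => //; rewrite leq_mul2r; apply/orP; right.
apply: leq_trans (Hlsz x); apply: leq_trans (ltnW (size_csz _)).
by rewrite size_take; case: ltnP => // /ltnW.
Qed.


Lemma FP_rev X A `{Code X} `{Code A} (l : X -> seq A) : FP l -> FP (fun x => rev (l x)).
Proof.
move=> Hl; apply: (@eq_FP _ _ _ _ (fun x => foldl (fun s a => a :: s) [::] (l x))).
  move=> x; elim/last_ind: (l x) => //= s a IH.
  by rewrite foldl_rcons IH rev_rcons.
apply: (@FP_foldl_growth _ _ _ _ _ _ (fun _ s a => a :: s) _ _ (fun n => n + 1)) => //.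
- exact: FP_const.
- by apply: FP_cons; [exact: FP_proj2 | apply: FP_snd; exact: FP_proj1].
- by polyb.
- by move=> x s a; rewrite csz_cons; lia.
Qed.

Section Lists.
Context {X S A B : Type} `{Code X} `{Code S} `{Code A} `{Code B}.

Lemma FP_map (f : X -> A -> B) (l : X -> seq A) :
  FP l -> FP (fun p : X * A => f p.1 p.2) -> FP (fun x => [seq f x a | a <- l x]).
Proof.
move=> Hl Hf.
apply: (@eq_FP _ _ _ _ (fun x => rev (foldl (fun s a => f x a :: s) [::] (l x)))).
  move=> x; elim/last_ind: (l x) => //= s a IH.
  by rewrite foldl_rcons rev_cons IH map_rcons.
have [T HT Hsz] := FP_size Hf.
apply: FP_rev.
apply: (@FP_foldl_growth _ _ _ _ _ _ (fun x s a => f x a :: s) _ _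
  (fun n => T (n + 1) + 1)) => //.
- exact: FP_const.
- apply: FP_cons; last by apply: FP_snd; exact: FP_proj1.
  by apply: (FP_app2 Hf); [apply: FP_fst; exact: FP_proj1 | exact: FP_proj2].
- have Hc : poly_bounded (fun n => T (n + 1)) by apply: (polyb_comp HT); polyb.
  by polyb.
- by move=> x s a; rewrite csz_cons; move: (Hsz (x, a)); rewrite csz_pair -addn1 /=; lia.
Qed.

Lemma FP_iter (f : X -> S -> S) (n : X -> nat) (s : X -> S) T :
  FP n -> FP s -> FP (fun p : X * S => f p.1 p.2) ->
  poly_bounded T -> (forall x s, csz (f x s) <= csz s + T (csz x)) ->
  FP (fun x => iter (n x) (f x) (s x)).
Proof.
move=> Hn Hs Hf [d Hd] Hg.
apply: (@eq_FP _ _ _ _ (fun x => foldl (fun s _ => f x s) (s x) (nseq (n x) tt))).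
  by move=> x; elim: (n x) (s x) => //= k IH y; rewrite IH -iterSr.
apply: (@FP_foldl_growth _ _ _ _ _ _ (fun x s _ => f x s) _ _ (fun n => (n + 2) ^ d)) => //.
- exact: FP_nseq.
- exact: (FP_comp Hf FP_proj1).
- exact: polyb_pow.
- move=> x y a; apply: leq_trans (Hg x y) _; rewrite leq_add2l.
  by apply: leq_trans (Hd _) _; apply: pow_mono; lia.
Qed.

Lemma FP_iter_bounded (f : X -> S -> S) (n : X -> nat) (s : X -> S) T :
  FP n -> FP s -> FP (fun p : X * S => f p.1 p.2) ->
  poly_bounded T -> (forall x s, csz (f x s) <= maxn (csz s) (T (csz x))) ->
  FP (fun x => iter (n x) (f x) (s x)).
Proof.
move=> Hn Hs Hf HT Hg; apply: FP_iter HT _ => // x y.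
by apply: leq_trans (Hg x y) _; rewrite geq_max; lia.
Qed.

Lemma FP_count (p : X -> A -> bool) (l : X -> seq A) :
  FP l -> FP (fun q : X * A => p q.1 q.2) -> FP (fun x => count (p x) (l x)).
Proof.
move=> Hl Hp.
apply: (@eq_FP _ _ _ _ (fun x => foldl (fun n a => if p x a then n.+1 else n) 0 (l x))).
  move=> x; elim/last_ind: (l x) => //= s a IH.
  by rewrite foldl_rcons -cats1 count_cat IH /=; case: (p x a); lia.
apply: (@FP_foldl_growth _ _ _ _ _ _ (fun x n a => if p x a then n.+1 else n) _ _
  (fun n => 2)) => //.
- exact: FP_const.
- have F : FP (fun q : X * nat * A => q.1.2) by apply: FP_snd; exact: FP_proj1.
  apply: FP_if => //; last exact: FP_succ.
  by apply: (FP_app2 Hp); [apply: FP_fst; exact: FP_proj1 | exact: FP_proj2].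
- by polyb.
- by move=> x n a; case: ifP => _; rewrite !csz_nat; lia.
Qed.

Lemma FP_filter (p : X -> A -> bool) (l : X -> seq A) :
  FP l -> FP (fun q : X * A => p q.1 q.2) -> FP (fun x => [seq a <- l x | p x a]).
Proof.
move=> Hl Hp.
apply: (@eq_FP _ _ _ _
  (fun x => rev (foldl (fun s a => if p x a then a :: s else s) [::] (l x)))).
  move=> x; elim/last_ind: (l x) => //= s a IH.
  by rewrite foldl_rcons filter_rcons; case: (p x a); rewrite ?rev_cons IH.
apply: FP_rev.
apply: (@FP_foldl_growth _ _ _ _ _ _ (fun x s a => if p x a then a :: s else s) _ _
  (fun n => n + 1)) => //.
- exact: FP_const.
- have F : FP (fun q : X * seq A * A => q.1.2) by apply: FP_snd; exact: FP_proj1.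
  apply: FP_if => //; last by apply: FP_cons => //; exact: FP_proj2.
  by apply: (FP_app2 Hp); [apply: FP_fst; exact: FP_proj1 | exact: FP_proj2].
- by polyb.
- by move=> x s a; case: ifP => _; rewrite ?csz_cons; lia.
Qed.

Lemma FP_cat (l r : X -> seq A) : FP l -> FP r -> FP (fun x => l x ++ r x).
Proof.
move=> Hl Hr.
apply: (@eq_FP _ _ _ _ (fun x => foldl (fun s a => a :: s) (r x) (rev (l x)))).
  move=> x; rewrite -{2}(revK (l x)); elim: (rev (l x)) (r x) => //= a s IH y.
  by rewrite IH rev_cons cat_rcons.
apply: (@FP_foldl_growth _ _ _ _ _ _ (fun _ s a => a :: s) _ _ (fun n => n + 1)) => //.
- exact: FP_rev.
- by apply: FP_cons; [exact: FP_proj2 | apply: FP_snd; exact: FP_proj1].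
- by polyb.
- by move=> x s a; rewrite csz_cons; lia.
Qed.

End Lists.

Lemma csz_cat A `{Code A} (s r : seq A) : csz (s ++ r) <= csz s + csz r.
Proof. by elim: s => [|a s IH] /=; rewrite ?csz_cons; lia. Qed.

Section Lists2.
Context {X A : Type} `{Code X} `{Code A}.

Lemma FP_flatten (l : X -> seq (seq A)) : FP l -> FP (fun x => flatten (l x)).
Proof.
move=> Hl; apply: (@eq_FP _ _ _ _ (fun x => foldl (fun s a => a ++ s) [::] (rev (l x)))).
  by move=> x; rewrite foldl_rev; elim: (l x) => //= a s ->.
apply: (@FP_foldl_growth _ _ _ _ _ _ (fun _ s a => a ++ s) _ _ (fun n => n)) => //.
- exact: FP_rev.
- exact: FP_const.
- by apply: FP_cat; [exact: FP_proj2 | apply: FP_snd; exact: FP_proj1].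
- by polyb.
- by move=> x s a; apply: leq_trans (csz_cat a s) _; rewrite addnC leq_add2l leq_addl.
Qed.

Lemma FP_addn (m n : X -> nat) : FP m -> FP n -> FP (fun x => m x + n x).
Proof.
move=> Hm Hn; apply: (@eq_FP _ _ _ _ (fun x => iter (m x) succn (n x))).
  by move=> x; rewrite iter_addn_0 || (elim: (m x) => //= k ->).
apply: (@FP_iter _ _ _ _ (fun _ => succn) _ _ (fun=> 2)) => //; first exact/FP_succ/FP_proj2.
  by polyb.
by move=> x k; rewrite !csz_nat; lia.
Qed.

Lemma FP_subn (m n : X -> nat) : FP m -> FP n -> FP (fun x => m x - n x).
Proof.
move=> Hm Hn; apply: (@eq_FP _ _ _ _ (fun x => iter (n x) predn (m x))).
  by move=> x; elim: (n x) => [|k IH] /=; rewrite ?subn0 // IH subnS.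
apply: (@FP_iter _ _ _ _ (fun _ => predn) _ _ (fun=> 0)) => //; first exact/FP_pred/FP_proj2.
  by polyb.
by move=> x k; rewrite !csz_nat; lia.
Qed.

End Lists2.

Section Arithmetic.
Context {X A : Type} `{Code X} `{Code A}.

Lemma FP_muln (m n : X -> nat) : FP m -> FP n -> FP (fun x => m x * n x).
Proof.
move=> Hm Hn; apply: (@eq_FP _ _ _ _ (fun x => iter (m x) (addn (n x)) 0)).
  by move=> x; rewrite iter_addn_0 mulnC.
have [T HT Hsz] := FP_size Hn.
apply: (@FP_iter _ _ _ _ (fun x => addn (n x)) _ _ T) => //; first exact: FP_const.
  by apply: FP_addn; [exact: (FP_comp Hn FP_proj1) | exact: FP_proj2].
by move=> x k; have := Hsz x; rewrite !csz_nat; lia.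
Qed.

Lemma FP_eqn0 (m : X -> nat) : FP m -> FP (fun x => m x == 0).
Proof.
move=> /FP_nseq Hm.
apply: (eq_FP _ (FP_case (g := fun _ _ _ => false) Hm (FP_const true) (FP_const false))).
by move=> x; case: (m x).
Qed.

Lemma FP_leq (m n : X -> nat) : FP m -> FP n -> FP (fun x => m x <= n x).
Proof. by move=> Hm Hn; apply: FP_eqn0; apply: FP_subn. Qed.

Lemma FP_negb (b : X -> bool) : FP b -> FP (fun x => ~~ b x).
Proof. by move=> Hb; apply: FP_if => //; exact: FP_const. Qed.

Lemma FP_andb (a b : X -> bool) : FP a -> FP b -> FP (fun x => a x && b x).
Proof. by move=> Ha Hb; apply: FP_if => //; exact: FP_const. Qed.

Lemma FP_orb (a b : X -> bool) : FP a -> FP b -> FP (fun x => a x || b x).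
Proof. by move=> Ha Hb; apply: FP_if => //; exact: FP_const. Qed.

Lemma FP_eqn (m n : X -> nat) : FP m -> FP n -> FP (fun x => m x == n x).
Proof.
move=> Hm Hn; apply: (@eq_FP _ _ _ _ (fun x => (m x <= n x) && (n x <= m x))).
  by move=> x; rewrite eqn_leq.
by apply: FP_andb; exact: FP_leq.
Qed.

Lemma FP_minn (m n : X -> nat) : FP m -> FP n -> FP (fun x => minn (m x) (n x)).
Proof. by move=> Hm Hn; apply: FP_if => //; apply: FP_leq => //; exact: FP_succ. Qed.

Lemma FP_size_seq (l : X -> seq A) : FP l -> FP (fun x => size (l x)).
Proof.
move=> Hl; apply: (@eq_FP _ _ _ _ (fun x => count predT (l x))).
  by move=> x; rewrite count_predT.
by apply: (FP_count (p := fun _ => predT)) => //; exact: FP_const.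
Qed.

Lemma FP_has (p : X -> A -> bool) (l : X -> seq A) :
  FP l -> FP (fun q : X * A => p q.1 q.2) -> FP (fun x => has (p x) (l x)).
Proof.
move=> Hl Hp; apply: (@eq_FP _ _ _ _ (fun x => 0 < count (p x) (l x))).
  by move=> x; rewrite has_count.
by apply: FP_leq; [exact: FP_const | exact: FP_count].
Qed.

Lemma csz_behead (l : seq A) : csz (behead l) <= csz l.
Proof. by case: l => //= a l; rewrite csz_cons; lia. Qed.

Lemma FP_drop (n : X -> nat) (l : X -> seq A) :
  FP n -> FP l -> FP (fun x => drop (n x) (l x)).
Proof.
move=> Hn Hl; apply: (@eq_FP _ _ _ _ (fun x => iter (n x) behead (l x))).
  move=> x; elim: (n x) (l x) => [|k IH] s; first by rewrite drop0.
  by rewrite iterSr IH; case: s.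
apply: (@FP_iter _ _ _ _ (fun _ => behead) _ _ (fun=> 0)) => //; first exact/FP_behead/FP_proj2.
  by polyb.
by move=> x s; have := csz_behead s; lia.
Qed.

Lemma FP_nth (a : X -> A) (l : X -> seq A) (n : X -> nat) :
  FP a -> FP l -> FP n -> FP (fun x => nth (a x) (l x) (n x)).
Proof.
move=> Ha Hl Hn; apply: (@eq_FP _ _ _ _ (fun x => head (a x) (drop (n x) (l x)))).
  by move=> x; rewrite -nth0 nth_drop addn0.
by apply: FP_head => //; apply: FP_drop.
Qed.

End Arithmetic.

Lemma FP_iota X `{Code X} (n : X -> nat) : FP n -> FP (fun x => iota 0 (n x)).
Proof.
move=> Hn.
apply: (@eq_FP _ _ _ _
  (fun x => rev (iter (n x) (fun s => size s :: s) [::]))).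
  move=> x; elim: (n x) => [//|k IH].
  rewrite iterS rev_cons IH -[k.+1]addn1 iotaD cats1 add0n; congr rcons.
  by rewrite -(size_rev (iter _ _ _)) IH size_iota.
apply: FP_rev.
(* The guard always succeeds during the actual run; it is inserted because the growth condition of
   [FP_iter] must hold for arbitrary states, including long lists. *)
apply: (@eq_FP _ _ _ _ (fun x =>
   iter (n x) (fun s => if size s < n x then size s :: s else s) [::])).
  move=> x; have : n x <= n x by []; move: {1 3 5}(n x) => k Hk.
  have Hsz j : size (iter j (fun s : seq nat => size s :: s) [::]) = j.
    by elim: j => //= j ->.
  by elim: k Hk => //= k IH Hk; rewrite IH ?Hsz ?Hk //; lia.
have [T HT Hsz] := FP_size Hn.
apply: (@FP_iter _ _ _ _ (fun x (s : seq nat) => if size s < n x then size s :: s else s)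
   _ _ (fun k => T k + 2)) => //; first exact: FP_const.
- have F : FP (fun p : X * seq nat => size p.2).
    apply: (@eq_FP _ _ _ _ (fun p : X * seq nat => count predT p.2)).
      by move=> x; rewrite count_predT.
    by apply: (FP_count (p := fun _ => predT)); [exact: FP_proj2 | exact: FP_const].
  apply: FP_if; last exact: FP_proj2.
    by apply: FP_leq; [exact: FP_succ | exact: (FP_comp Hn FP_proj1)].
  by apply: FP_cons => //; exact: FP_proj2.
- by polyb.
- move=> x s; have := Hsz x; case: ltnP => Hs; rewrite ?csz_cons !csz_nat; lia.
Qed.

(** * From list functions to Turing machines *)

Definition sym_nat (a : symbol) : nat := if a is Some b then nat_of_bool b else 2.

Fixpoint push_word (s : seq symbol) : cmd :=
  if s is a :: s' then Seq (push_word s') (Push MS a) else Skip.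

Lemma exec_push_word s i m a b f :
  exec (push_word s) (Mem i m a b f) (size s).+1 (Mem i (s ++ m) a b f).
Proof.
elim: s => [|c s IH]; first exact: ExecSkip.
apply: (@exec_eqt _ _ ((size s).+1 + 1)); last by rewrite addn1.
by apply: ExecSeq IH _; apply: ExecPush.
Qed.

Definition load_symbol (a : symbol) : cmd :=
  (push_word (sym1 :: word (code (sym_nat a))) ;; Push FS sym1)%cmd.

(** The input is popped last symbol first, so putting each symbol in front of the list built so far
    restores the order of reading. *)
Definition load : cmd :=
  (Push MS sym0 ;; Push FS sym1 ;;
   While FS (Case IO (Push FS sym0) (load_symbol sym0) (load_symbol sym1)
               (load_symbol symH)))%cmd.

Lemma exec_load w : exists2 t, t <= 20 * size w + 10 &
  exec load (Mem (rev w) [::] [::] [::] [::]) t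
    (Mem [::] (word (code (map sym_nat w)) ++ [::]) [::] [::] [::]).
Proof.
have E0 : forall s, exists2 t, t <= 20 * size w + 7 &
  exec (While FS (Case IO (Push FS sym0) (load_symbol sym0) (load_symbol sym1)
               (load_symbol symH)))
    (Mem (rev w) (word (code (map sym_nat s))) [::] [::] [:: sym1]) t
    (Mem [::] (word (code (map sym_nat (w ++ s)))) [::] [::] [::]).
  elim/last_ind: w => [|w a IH] s.
    exists (2 + (1.+2 + 2)) => //.
    apply: ExecLoop => //; first by apply: ExecCase; apply: ExecPush.
    exact: ExecStop.
  have [t Ht E] := IH (a :: s); rewrite rev_rcons cat_rcons size_rcons.
  exists (2 + (((size (sym1 :: word (code (sym_nat a)))).+1 + 1).+2 + t)).
    have Ha : size (sym1 :: word (code (sym_nat a))) <= 6 by case: a {E} => [[]|].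
    by rewrite mulnS; move: Ht Ha; lia.
  apply: ExecLoop E => //.
  apply: ExecCase.
  rewrite [branch _ _ _ _ _](_ : _ = load_symbol a); last by case: a => [[]|].
  apply: ExecSeq; first exact: exec_push_word.
  exact: ExecPush.
have [t Ht E] := E0 [::].
exists (1 + (1 + t)); first by lia.
rewrite !cats0 in E *.
apply: ExecSeq; first exact: ExecPush.
by apply: ExecSeq; first exact: ExecPush.
Qed.

Definition emit (a : symbol) : cmd := (Push IO a ;; Push FS sym1)%cmd.

(** The preorder words of the codes of 0, 1 and 2 are 0, 100 and 10100; the nested cases are their
    decision tree. *)
Definition unload_symbol : cmd :=
  Case MS Skip (emit sym0)
    (Case MS Skip
       (Case MS Skip (emit sym1)
          (Case MS Skip (Case MS Skip (emit symH) Skip Skip) Skip Skip) Skip)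
       Skip Skip) Skip.

Definition unload : cmd :=
  (Push FS sym1 ;; While FS (Case MS Skip (Push FS sym0) unload_symbol Skip))%cmd.

Lemma exec_unload_symbol a i m s : exists2 t, t <= 12 &
  exec unload_symbol (Mem i (word (code (sym_nat a)) ++ m) [::] [::] s) t
    (Mem (a :: i) m [::] [::] (sym1 :: s)).
Proof.
have F b j m' : exec (emit b) (Mem j m' [::] [::] s) 2 (Mem (b :: j) m' [::] [::] (sym1 :: s)).
  by apply: (@ExecSeq _ _ _ 1 _ 1); exact: ExecPush.
case: a => [[]|] /=.
- by exists 8 => //; do 3!apply: ExecCase => /=; apply: F.
- by exists 4 => //; do 1!apply: ExecCase => /=; apply: F.
- by exists 12 => //; do 5!apply: ExecCase => /=; apply: F.
Qed.

Lemma exec_unload w : exists2 t, t <= 20 * size w + 10 &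
  exec unload (Mem [::] (word (code (map sym_nat w)) ++ [::]) [::] [::] [::]) t
    (Mem (rev w) [::] [::] [::] [::]).
Proof.
have E0 : forall i, exists2 t, t <= 20 * size w + 7 &
  exec (While FS (Case MS Skip (Push FS sym0) unload_symbol Skip))
    (Mem i (word (code (map sym_nat w))) [::] [::] [:: sym1]) t
    (Mem (rev w ++ i) [::] [::] [::] [::]).
  elim: w => [|a w IH] i.
    exists (2 + (1.+2 + 2)) => //.
    apply: ExecLoop => //; first by apply: ExecCase; apply: ExecPush.
    exact: ExecStop.
  have [t Ht E] := IH (a :: i); rewrite rev_cons cat_rcons.
  have [u Hu F] := exec_unload_symbol a i (word (code (map sym_nat w))) [::].
  exists (2 + (u.+2 + t)); first by rewrite -[size (a :: w)]/(size w).+1 mulnS; move: Ht Hu; lia.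
  apply: ExecLoop E => //.
  by apply: ExecCase.
have [t Ht E] := E0 [::].
exists (1 + t); first by lia.
rewrite !cats0 in E *.
by apply: ExecSeq; first exact: ExecPush.
Qed.

Lemma exprn_nat (m n : nat) : (m ^+ n)%R = (m ^ n)%N.
Proof. by elim: n => //= n IH; rewrite exprS IH expnS. Qed.

(** The output is introduced by an equation because a list of numbers denotes a word only if all its
    entries are at most 2. *)
Lemma FP_machine (f : seq nat -> seq nat) : FP f ->
  exists (M : machine symbol) (p : {poly nat}),
    forall w out, f (map sym_nat w) = map sym_nat out ->
    exists2 t, t <= horner p (size w) & outputs_within M w t out.
Proof.
move=> [c [d Hc]].
(* The summands are the input length, the output length, the times of [load], [c] and [unload], and
   the 3 of [exec_outputs]; [7 * n + 1] bounds the code of an input of length [n]. *)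
have [e He] : poly_bounded (fun n => n + (7 * n + 1 + (7 * n + 1 + 2) ^ d) +
   ((20 * n + 10) + (((7 * n + 1 + 2) ^ d) + (20 * (7 * n + 1 + (7 * n + 1 + 2) ^ d) + 10))) + 3).
  have Hp : poly_bounded (fun n => (7 * n + 1 + 2) ^ d).
    by apply: (polyb_comp (polyb_pow d)); polyb.
  by polyb.
exists (stack_machine (compile (load ;; c ;; unload) 0 (csize (load ;; c ;; unload)))).
exists (('X + 2%:R%:P) ^+ e)%R => w out E.
have [t1 Ht1 E1] := exec_load w.
have [t2 Ht2 E2] := Hc (map sym_nat w) [::] [::] [::] [::] [::].
have [t3 Ht3 E3] := exec_unload out.
have Hcin : csz (map sym_nat w) <= 7 * size w + 1.
  elim: w {E E1 Ht1 t2 Ht2 E2} => [//|a w IH].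
  rewrite map_cons csz_cons csz_nat -[size (a :: w)]/(size w).+1 mulnS -addnA -addSn.
  by apply: leq_add IH; case: a => [[]|].
have Hcout : size out <= csz (map sym_nat w) + (csz (map sym_nat w) + 2) ^ d.
  have := run_size (Hc (map sym_nat w)); rewrite E.
  apply: leq_trans; rewrite -(size_map sym_nat out); exact/ltnW/size_csz.
rewrite E in E2.
have Ex := ExecSeq E1 (ExecSeq E2 E3).
have [M [-> HM]] := exec_outputs Ex erefl.
exists (size w + size out + (t1 + (t2 + t3)) + 3) => //.
rewrite horner_exp hornerD hornerX hornerC exprn_nat.
apply: leq_trans (He (size w)).
have Hd : (csz (map sym_nat w) + 2) ^ d <= (7 * size w + 1 + 2) ^ d by exact: pow_mono.
by move: Ht1 Ht2 Ht3 Hcin Hcout Hd; lia.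
Qed.

Lemma FP_app4 X A B C D E `{Code X} `{Code A} `{Code B} `{Code C} `{Code D} `{Code E}
    (f : A -> B -> C -> D -> E) (a : X -> A) (b : X -> B) (c : X -> C) (d : X -> D) :
  FP (fun p : A * B * C * D => f p.1.1.1 p.1.1.2 p.1.2 p.2) ->
  FP a -> FP b -> FP c -> FP d -> FP (fun x => f (a x) (b x) (c x) (d x)).
Proof.
by move=> Hf Ha Hb Hc Hd; exact: (FP_comp Hf (FP_pair (FP_pair (FP_pair Ha Hb) Hc) Hd)).
Qed.

Lemma FP_app5 X A B C D E F `{Code X} `{Code A} `{Code B} `{Code C} `{Code D} `{Code E}
    `{Code F} (f : A -> B -> C -> D -> E -> F)
    (a : X -> A) (b : X -> B) (c : X -> C) (d : X -> D) (e : X -> E) :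
  FP (fun p : A * B * C * D * E => f p.1.1.1.1 p.1.1.1.2 p.1.1.2 p.1.2 p.2) ->
  FP a -> FP b -> FP c -> FP d -> FP e ->
  FP (fun x => f (a x) (b x) (c x) (d x) (e x)).
Proof.
move=> Hf Ha Hb Hc Hd He.
exact: (FP_comp Hf (FP_pair (FP_pair (FP_pair (FP_pair Ha Hb) Hc) Hd) He)).
Qed.

Create HintDb fpdb.

(** Analyses the body of the function by its head symbol, using higher-order patterns for the
    arguments. A defined function is looked up in [fpdb], where it is registered in uncurried
    form. *)
Ltac fp1 := cbv beta; match goal with
  | |- FP (fun x => x) => exact: FP_id
  | |- FP (@fst _ _) => exact: FP_proj1
  | |- FP (@snd _ _) => exact: FP_proj2
  | |- FP (fun x => ?k) => exact: FP_const
  | |- FP (fun x => @fst _ _ (@?f x)) => refine (FP_fst (f := f) _)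
  | |- FP (fun x => @snd _ _ (@?f x)) => refine (FP_snd (f := f) _)
  | |- FP (fun x => (@?f x, @?g x)) => refine (FP_pair (f := f) (g := g) _ _)
  | |- FP (fun x => (@?f x) :: (@?g x)) => refine (FP_cons (f := f) (g := g) _ _)
  | |- FP (fun x => (@?f x) ++ (@?g x)) => refine (FP_cat (l := f) (r := g) _ _)
  | |- FP (fun x => (@?a x) && (@?b x)) => refine (FP_andb (a := a) (b := b) _ _)
  | |- FP (fun x => (@?a x) || (@?b x)) => refine (FP_orb (a := a) (b := b) _ _)
  | |- FP (fun x => ~~ (@?a x)) => refine (FP_negb (b := a) _)
  | |- FP (fun x => (@?a x).+1) => refine (FP_succ (f := a) _)
  | |- FP (fun x => (@?a x).-1) => refine (FP_pred (f := a) _)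
  | |- FP (fun x => (@?a x) <= (@?b x)) => refine (FP_leq (m := a) (n := b) _ _)
  | |- FP (fun x => @eq_op _ (@?a x) (@?b x)) => refine (FP_eqn (m := a) (n := b) _ _)
  | |- FP (fun x => (@?a x) + (@?b x)) => refine (FP_addn (m := a) (n := b) _ _)
  | |- FP (fun x => (@?a x) - (@?b x)) => refine (FP_subn (m := a) (n := b) _ _)
  | |- FP (fun x => (@?a x) * (@?b x)) => refine (FP_muln (m := a) (n := b) _ _)
  | |- FP (fun x => minn (@?a x) (@?b x)) => refine (FP_minn (m := a) (n := b) _ _)
  | |- FP (fun x => nat_of_bool (@?b x)) => refine (FP_nat_of_bool (b := b) _)
  | |- FP (fun x => iota 0 (@?b x)) => refine (FP_iota (n := b) _)
  | |- FP (fun x => rev (@?b x)) => refine (FP_rev (l := b) _)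
  | |- FP (fun x => flatten (@?b x)) => refine (FP_flatten (l := b) _)
  | |- FP (fun x => size (@?b x)) => refine (FP_size_seq (l := b) _)
  | |- FP (fun x => head (@?a x) (@?b x)) => refine (FP_head (a := a) (l := b) _ _)
  | |- FP (fun x => nth (@?a x) (@?b x) (@?c x)) =>
      refine (FP_nth (a := a) (l := b) (n := c) _ _ _)
  | |- FP (fun x => map (@?f x) (@?l x)) => refine (FP_map (f := f) (l := l) _ _)
  | |- FP (fun x => filter (@?f x) (@?l x)) => refine (FP_filter (p := f) (l := l) _ _)
  | |- FP (fun x => count (@?f x) (@?l x)) => refine (FP_count (p := f) (l := l) _ _)
  | |- FP (fun x => has (@?f x) (@?l x)) => refine (FP_has (p := f) (l := l) _ _)
  | |- FP (fun x => ?f (@?a x)) =>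
      refine (FP_comp (f := f) (g := a) _ _); [solve [auto with nocore fpdb] | ]
  | |- FP (fun x => ?f (@?a x) (@?b x)) =>
      refine (FP_app2 (f := f) (a := a) (b := b) _ _ _); [solve [auto with nocore fpdb] | |]
  | |- FP (fun x => ?f (@?a x) (@?b x) (@?c x)) =>
      refine (FP_app3 (f := f) (a := a) (b := b) (c := c) _ _ _ _);
      [solve [auto with nocore fpdb] | | |]
  | |- FP (fun x => ?f (@?a x) (@?b x) (@?c x) (@?d x)) =>
      refine (FP_app4 (f := f) (a := a) (b := b) (c := c) (d := d) _ _ _ _ _);
      [solve [auto with nocore fpdb] | | | |]
  | |- FP (fun x => ?f (@?a x) (@?b x) (@?c x) (@?d x) (@?e x)) =>
      refine (FP_app5 (f := f) (a := a) (b := b) (c := c) (d := d) (e := e) _ _ _ _ _ _);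
      [solve [auto with nocore fpdb] | | | | |]
  | |- _ => simple eapply FP_if
  | |- _ => solve [auto with nocore fpdb]
  end.
Ltac fp := repeat fp1.

Lemma csz_bools (s : seq bool) : csz s <= 4 * size s + 1.
Proof.
elim: s => [//|b s IH]; rewrite csz_cons -[size (b :: s)]/(size s).+1 mulnS -addnA.
by rewrite -addSn; apply: leq_add IH; case: b.
Qed.

Lemma csz_bounded_nats n (s : seq nat) : all (geq n) s -> csz s <= (n.*2 + 2) * size s + 1.
Proof.
elim: s => [|b s IH]; first by rewrite muln0.
rewrite [all _ _]/= => /andP[Hb Hs].
rewrite csz_cons csz_nat -[size (b :: s)]/(size s).+1 mulnS -addnA -addSn.
by apply: leq_add; [move: Hb => /=; lia | exact: IH].
Qed.

(** * The algorithm *)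

Notation graph := (seq (nat * nat)).

Definition adj (E : graph) (u v : nat) : bool :=
  has (fun e => ((e.1 == u) && (e.2 == v)) || ((e.1 == v) && (e.2 == u))) E.

Definition outside (E : graph) (U : seq bool) (u : nat) : nat :=
  count (fun e => ((e.1 == u) && ~~ nth false U e.2)
               || ((e.2 == u) && ~~ nth false U e.1)) E.

Definition inside (E : graph) (U : seq bool) (u : nat) : nat :=
  count (fun e => ((e.1 == u) && nth false U e.2)
               || ((e.2 == u) && nth false U e.1)) E.

Definition prune (n : nat) (E : graph) (D : seq nat) (U : seq bool) : seq bool :=
  [seq nth false U u && (outside E U u <= nth 0 D u) | u <- iota 0 n].

(* Dhar's burning algorithm: what is left is the largest set avoiding [v] that
   can be fired. *)
Definition dhar (n : nat) (E : graph) (D : seq nat) (v : nat) : seq bool :=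
  iter n (prune n E D) [seq ~~ (u == v) | u <- iota 0 n].

(* Truncation at [n] keeps the numbers small on arbitrary inputs; it has no
   effect on divisors of degree at most [n]. *)
Definition fire (n : nat) (E : graph) (D : seq nat) (U : seq bool) : seq nat :=
  [seq minn n (if nth false U u then nth 0 D u - outside E U u
               else nth 0 D u + inside E U u) | u <- iota 0 n].

Definition advance (n : nat) (E : graph) (v : nat) (D : seq nat) : seq nat :=
  if 0 < nth 0 D v then D else fire n E D (dhar n E D v).

Definition chips (n : nat) (E : graph) (D : seq nat) (v r : nat) : seq nat :=
  iter r (advance n E v) D.

(** Once [v] has a chip, [advance] changes nothing, so the rounds without a chip form an initial
    segment and their number is the first hitting round. The range [n * n] exceeds [n] times the
    degree whenever the degree is below [n]. *)
Definition hit (n : nat) (E : graph) (D : seq nat) (v : nat) : nat :=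
  count (fun r => nth 0 (chips n E D v r) v == 0) (iota 0 (n * n)).

(* The least vertex of the last fired set that sends a chip to [v]. *)
Definition spark (n : nat) (E : graph) (D : seq nat) (v : nat) : nat :=
  count (fun i => ~~ has (fun u =>
     [&& u <= i, nth false (dhar n E (chips n E D v (hit n E D v).-1) v) u & adj E u v])
       (iota 0 n)) (iota 0 n).

Definition keys (n : nat) (E : graph) (D : seq nat) : seq (nat * nat) :=
  [seq (hit n E D v, spark n E D v) | v <- iota 0 n].

Definition before (K : seq (nat * nat)) (u v : nat) : bool :=
  ((nth (0, 0) K u).1 < (nth (0, 0) K v).1) ||
  (((nth (0, 0) K u).1 == (nth (0, 0) K v).1) &&
   (((nth (0, 0) K u).2 < (nth (0, 0) K v).2) ||
    (((nth (0, 0) K u).2 == (nth (0, 0) K v).2) && (u < v)))).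

Definition grow (n : nat) (E : graph) (K : seq (nat * nat)) (v : nat) (S : seq bool) :
    seq bool :=
  [seq nth false S u ||
       (~~ before K u v && has (fun w => nth false S w && adj E w u) (iota 0 n))
  | u <- iota 0 n].

Definition later (n : nat) (E : graph) (K : seq (nat * nat)) (v : nat) : seq bool :=
  iter n (grow n E K v) [seq u == v | u <- iota 0 n].

(** The earlier members are the earlier neighbours of [v] in the fill-in graph of the elimination
    order, in which later vertices are eliminated first. *)
Definition bag (n : nat) (E : graph) (K : seq (nat * nat)) (v : nat) : seq bool :=
  [seq (y == v) ||
       (before K y v && has (fun w => nth false (later n E K v) w && adj E y w) (iota 0 n))
  | y <- iota 0 n].

Definition bag_rest (n : nat) (E : graph) (K : seq (nat * nat)) (v y : nat) : bool :=
  ~~ (y == v) && nth false (bag n E K v) y.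

Definition nonroot (n : nat) (K : seq (nat * nat)) (v : nat) : bool :=
  has (fun y => before K y v) (iota 0 n).

(** The latest of the other members of the bag, as in an elimination tree. A bag without other
    members is attached to the first vertex of the order, so that the result is a single tree in all
    cases. *)
Definition parent (n : nat) (E : graph) (K : seq (nat * nat)) (v : nat) : nat :=
  head (head 0 [seq r <- iota 0 n | ~~ nonroot n K r])
    [seq y <- iota 0 n | bag_rest n E K v y &&
       ~~ has (fun z => bag_rest n E K v z && before K y z) (iota 0 n)].

Definition tree_edges (n : nat) (E : graph) (K : seq (nat * nat)) : seq (nat * nat) :=
  [seq (v, parent n E K v) | v <- [seq v <- iota 0 n | nonroot n K v]].

Definition decomposition (n : nat) (E : graph) (K : seq (nat * nat)) : seq nat :=
  n :: size (tree_edges n E K) ::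
  flatten [seq [:: e.1; e.2] | e <- tree_edges n E K] ++
  flatten [seq [seq nat_of_bool b | b <- bag n E K v] | v <- iota 0 n].

(** Halving and the logarithm are expressed as counts over [iota], to stay within the closure
    lemmas. *)
Definition halve (n : nat) : nat := count (fun i => i + i.+1 < n) (iota 0 n).

Definition halves (i n : nat) : nat := iter i halve n.

Definition log2 (n : nat) : nat := count (fun i => 0 < halves i.+1 n) (iota 0 n).

Definition digits (n : nat) : seq nat :=
  [seq halves i n - (halves i.+1 n + halves i.+1 n)
  | i <- iota 0 (log2 n).+1] ++ [:: 2].

(** Horner's rule, most significant digit first, capped at every step: a binary numeral can denote
    an exponentially large number, whose unary code would be too long. *)
Definition value (N : nat) (s : seq nat) : nat :=
  foldl (fun v b => minn N (v + v + b)) 0 s.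

Definition read_symbol (N : nat) (st : seq nat * seq nat) (a : nat) : seq nat * seq nat :=
  if a == 2 then (value N st.2 :: st.1, [::]) else (st.1, a :: st.2).

(** The cap is the input length. On an encoded instance it is at least the number of vertices and
    the number of edges, so only chip numbers can be altered. *)
Definition parse (w : seq nat) : seq nat :=
  rev (foldl (read_symbol (size w)) ([::], [::]) w).1.

Definition input_edges (s : seq nat) : graph :=
  [seq (nth 0 s (i + i).+2, nth 0 s (i + i).+3) | i <- iota 0 (nth 0 s 1)].

Definition input_divisor (s : seq nat) : seq nat :=
  [seq nth 0 s (nth 0 s 1 + nth 0 s 1 + v).+2 | v <- iota 0 (nth 0 s 0)].

Definition solve (s : seq nat) : seq nat :=
  decomposition (nth 0 s 0) (input_edges s)
    (keys (nth 0 s 0) (input_edges s) (input_divisor s)).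

Definition algorithm (w : seq nat) : seq nat :=
  flatten [seq digits a | a <- solve (parse w)].

(** * The algorithm runs in polynomial time *)

Lemma FP_adj : FP (fun p : graph * nat * nat => adj p.1.1 p.1.2 p.2).
Proof. by rewrite /adj; fp. Qed.
#[local] Hint Resolve FP_adj : fpdb.

Lemma FP_outside : FP (fun p : graph * seq bool * nat => outside p.1.1 p.1.2 p.2).
Proof. by rewrite /outside; fp. Qed.
#[local] Hint Resolve FP_outside : fpdb.

Lemma FP_inside : FP (fun p : graph * seq bool * nat => inside p.1.1 p.1.2 p.2).
Proof. by rewrite /inside; fp. Qed.
#[local] Hint Resolve FP_inside : fpdb.

Lemma FP_prune :
  FP (fun p : nat * graph * seq nat * seq bool => prune p.1.1.1 p.1.1.2 p.1.2 p.2).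
Proof. by rewrite /prune; fp. Qed.
#[local] Hint Resolve FP_prune : fpdb.

Lemma nat_csz (n : nat) : n <= csz n.
Proof. by rewrite csz_nat; lia. Qed.

Lemma csz_seq_bool n (F : nat -> bool) : csz [seq F u | u <- iota 0 n] <= 4 * csz n + 1.
Proof.
apply: leq_trans (csz_bools _) _; rewrite size_map size_iota leq_add2r leq_mul2l.
exact: nat_csz.
Qed.

Lemma FP_dhar : FP (fun p : nat * graph * seq nat * nat => dhar p.1.1.1 p.1.1.2 p.1.2 p.2).
Proof.
rewrite /dhar; apply: (@FP_iter_bounded _ _ _ _
  (fun p : nat * graph * seq nat * nat => prune p.1.1.1 p.1.1.2 p.1.2)
  _ _ (fun n => 4 * n + 1)); [by fp | by fp | by fp | by polyb |].
move=> [[[n E] D] v] U /=; rewrite leq_max; apply/orP; right.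
apply: leq_trans (csz_seq_bool _ _) _; rewrite !csz_pair; lia.
Qed.
#[local] Hint Resolve FP_dhar : fpdb.

Lemma FP_fire :
  FP (fun p : nat * graph * seq nat * seq bool => fire p.1.1.1 p.1.1.2 p.1.2 p.2).
Proof. by rewrite /fire; fp. Qed.
#[local] Hint Resolve FP_fire : fpdb.

Lemma FP_advance :
  FP (fun p : nat * graph * nat * seq nat => advance p.1.1.1 p.1.1.2 p.1.2 p.2).
Proof. by rewrite /advance; fp. Qed.
#[local] Hint Resolve FP_advance : fpdb.

Lemma csz_fire n E D U : csz (fire n E D U) <= (2 * n + 2) * n + 1.
Proof.
apply: leq_trans (csz_bounded_nats (n := n) _) _.
  by apply/allP => x /mapP[u _ ->] /=; rewrite geq_minl.
by rewrite size_map size_iota mul2n.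
Qed.

Lemma FP_chips :
  FP (fun p : nat * graph * seq nat * nat * nat => chips p.1.1.1.1 p.1.1.1.2 p.1.1.2 p.1.2 p.2).
Proof.
rewrite /chips; apply: (@FP_iter_bounded _ _ _ _
  (fun p : nat * graph * seq nat * nat * nat => advance p.1.1.1.1 p.1.1.1.2 p.1.2)
  _ _ (fun n => (2 * n + 2) * n + 1)); [by fp | by fp | by fp | by polyb |].
move=> [[[[n E] D0] v] r] D /=; rewrite /advance; case: ifP => _; first by rewrite leq_maxl.
rewrite leq_max; apply/orP; right; apply: leq_trans (csz_fire _ _ _ _) _.
have Hn : n <= csz (n, E, D0, v, r) by rewrite !csz_pair csz_nat; lia.
by rewrite leq_add2r leq_mul // leq_add2r leq_mul2l Hn.
Qed.
#[local] Hint Resolve FP_chips : fpdb.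

Lemma FP_hit : FP (fun p : nat * graph * seq nat * nat => hit p.1.1.1 p.1.1.2 p.1.2 p.2).
Proof. by rewrite /hit; fp. Qed.
#[local] Hint Resolve FP_hit : fpdb.

Lemma FP_spark : FP (fun p : nat * graph * seq nat * nat => spark p.1.1.1 p.1.1.2 p.1.2 p.2).
Proof. by rewrite /spark; fp. Qed.
#[local] Hint Resolve FP_spark : fpdb.

Lemma FP_keys : FP (fun p : nat * graph * seq nat => keys p.1.1 p.1.2 p.2).
Proof. by rewrite /keys; fp. Qed.
#[local] Hint Resolve FP_keys : fpdb.

Lemma FP_before : FP (fun p : seq (nat * nat) * nat * nat => before p.1.1 p.1.2 p.2).
Proof. by rewrite /before; fp. Qed.
#[local] Hint Resolve FP_before : fpdb.

Lemma FP_grow : FP (fun p : nat * graph * seq (nat * nat) * nat * seq bool =>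
  grow p.1.1.1.1 p.1.1.1.2 p.1.1.2 p.1.2 p.2).
Proof. by rewrite /grow; fp. Qed.
#[local] Hint Resolve FP_grow : fpdb.

Lemma FP_later :
  FP (fun p : nat * graph * seq (nat * nat) * nat => later p.1.1.1 p.1.1.2 p.1.2 p.2).
Proof.
rewrite /later; apply: (@FP_iter_bounded _ _ _ _
  (fun p : nat * graph * seq (nat * nat) * nat => grow p.1.1.1 p.1.1.2 p.1.2 p.2)
  _ _ (fun n => 4 * n + 1)); [by fp | by fp | by fp | by polyb |].
move=> [[[n E] D] v] U /=; rewrite leq_max; apply/orP; right.
apply: leq_trans (csz_seq_bool _ _) _; rewrite !csz_pair; lia.
Qed.
#[local] Hint Resolve FP_later : fpdb.

Lemma FP_bag :
  FP (fun p : nat * graph * seq (nat * nat) * nat => bag p.1.1.1 p.1.1.2 p.1.2 p.2).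
Proof. by rewrite /bag; fp. Qed.
#[local] Hint Resolve FP_bag : fpdb.

Lemma FP_bag_rest : FP (fun p : nat * graph * seq (nat * nat) * nat * nat =>
  bag_rest p.1.1.1.1 p.1.1.1.2 p.1.1.2 p.1.2 p.2).
Proof. by rewrite /bag_rest; fp. Qed.
#[local] Hint Resolve FP_bag_rest : fpdb.

Lemma FP_nonroot : FP (fun p : nat * seq (nat * nat) * nat => nonroot p.1.1 p.1.2 p.2).
Proof. by rewrite /nonroot; fp. Qed.
#[local] Hint Resolve FP_nonroot : fpdb.

Lemma FP_parent :
  FP (fun p : nat * graph * seq (nat * nat) * nat => parent p.1.1.1 p.1.1.2 p.1.2 p.2).
Proof. by rewrite /parent; fp. Qed.
#[local] Hint Resolve FP_parent : fpdb.

Lemma FP_tree_edges :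
  FP (fun p : nat * graph * seq (nat * nat) => tree_edges p.1.1 p.1.2 p.2).
Proof. by rewrite /tree_edges; fp. Qed.
#[local] Hint Resolve FP_tree_edges : fpdb.

Lemma FP_decomposition :
  FP (fun p : nat * graph * seq (nat * nat) => decomposition p.1.1 p.1.2 p.2).
Proof. by rewrite /decomposition; fp. Qed.
#[local] Hint Resolve FP_decomposition : fpdb.

Lemma FP_halve : FP halve.
Proof. by rewrite /halve; fp. Qed.
#[local] Hint Resolve FP_halve : fpdb.

Lemma halve_le n : halve n <= n.
Proof. by apply: leq_trans (count_size _ _) _; rewrite size_iota. Qed.

Lemma FP_halves : FP (fun p : nat * nat => halves p.1 p.2).
Proof.
rewrite /halves; apply: (@FP_iter_bounded _ _ _ _ (fun _ : nat * nat => halve)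
  _ _ (fun n => n)); [by fp | by fp | by fp | by polyb |].
by move=> p n; rewrite leq_max !csz_nat; have := halve_le n; lia.
Qed.
#[local] Hint Resolve FP_halves : fpdb.

Lemma FP_log2 : FP log2.
Proof. by rewrite /log2; fp. Qed.
#[local] Hint Resolve FP_log2 : fpdb.

Lemma FP_digits : FP digits.
Proof. by rewrite /digits; fp. Qed.
#[local] Hint Resolve FP_digits : fpdb.

Lemma FP_value : FP (fun p : nat * seq nat => value p.1 p.2).
Proof.
rewrite /value.
apply: (@FP_foldl_growth _ _ _ _ _ _ (fun (p : nat * seq nat) v b => minn p.1 (v + v + b))
  _ _ (fun n => n)); [by fp | by fp | by fp | by polyb |].
move=> [N s] v b /=; rewrite !csz_pair !csz_nat /=; have := geq_minl N (v + v + b).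
by move: (minn _ _); lia.
Qed.
#[local] Hint Resolve FP_value : fpdb.

Lemma FP_read_symbol :
  FP (fun p : nat * (seq nat * seq nat) * nat => read_symbol p.1.1 p.1.2 p.2).
Proof. by rewrite /read_symbol; fp. Qed.
#[local] Hint Resolve FP_read_symbol : fpdb.

Lemma value_le N s : value N s <= N.
Proof.
elim/last_ind: s => //= s a _.
by rewrite /value foldl_rcons geq_minl.
Qed.

Lemma FP_parse : FP parse.
Proof.
rewrite /parse; do 2!fp1.
apply: (@FP_foldl_growth _ _ _ _ _ _ (fun w : seq nat => read_symbol (size w))
  _ _ (fun n => 2 * n + 3)); [by fp | by fp | by fp | by polyb |].
move=> w [toks cur] a; rewrite /read_symbol; case: ifP => _ /=; rewrite !csz_pair csz_cons.
  have Hv : csz (value (size w) cur) <= 2 * csz w.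
    rewrite csz_nat -mul2n; apply: (@leq_trans (2 * (size w).+1)); last first.
      by rewrite leq_mul2l size_csz.
    by rewrite mulnS; have := value_le (size w) cur; lia.
  have Hc := csz_gt0 cur; rewrite csz_nil; move: Hv Hc.
  by move: (csz (value _ _)) (csz toks) (csz cur) (csz w) (csz a) => *; lia.
by lia.
Qed.
#[local] Hint Resolve FP_parse : fpdb.

Lemma FP_input_edges : FP input_edges.
Proof. by rewrite /input_edges; fp. Qed.
#[local] Hint Resolve FP_input_edges : fpdb.

Lemma FP_input_divisor : FP input_divisor.
Proof. by rewrite /input_divisor; fp. Qed.
#[local] Hint Resolve FP_input_divisor : fpdb.

Lemma FP_solve : FP solve.
Proof. by rewrite /solve; fp. Qed.
#[local] Hint Resolve FP_solve : fpdb.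

Lemma FP_algorithm : FP algorithm.
Proof. by rewrite /algorithm; fp. Qed.

(** * Chip firing *)

Section ChipFiring.
Variable G : multigraph.
Notation V := (vertex G).
Implicit Types (D F : {ffun V -> nat}) (U W : {set V}) (u v w : V).
Local Open Scope ring_scope.

Lemma edge_neq e : e \in edges G -> e.1 != e.2.
Proof. by case: G e => m s H e /=; move/(allP H). Qed.

Lemma adjacentP (u v : V) :
  reflect (exists2 e, e \in edges G & e = (u, v) \/ e = (v, u)) (adjacent u v).
Proof.
rewrite /adjacent /= -has_count; apply: (iffP hasP) => -[e He H]; exists e => //.
  by case/orP: H => /eqP; [left | right].
by case: H => ->; rewrite eqxx ?orbT.
Qed.

Lemma adjacent_sym : symmetric (@adjacent G).
Proof.
by move=> u v; apply/adjacentP/adjacentP => -[e He H]; exists e => //; case: H; auto.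
Qed.

(** Writing the Laplacian as a sum over edges treats parallel edges and orientations uniformly and
    turns sums over vertex sets into boundary sums. *)
Definition lap (x : V -> int) (u : V) : int :=
  \sum_(e <- edges G) ((e.1 == u)%:R * (x e.1 - x e.2) + (e.2 == u)%:R * (x e.2 - x e.1)).

Lemma count_sumr (T : Type) (p : pred T) (s : seq T) :
  (count p s)%:Z = \sum_(e <- s) (p e)%:R.
Proof.
by elim: s => [|e s IH]; rewrite ?big_nil // big_cons /= PoszD IH; case: (p e).
Qed.

Lemma laplacian_lap (x : 'cV[int]_(nverts G)) (u : V) :
  (laplacian G *m x) u 0 = lap (fun v => x v 0) u.
Proof.
rewrite mxE.
pose l (e : V * V) v : int := if u == v then ((e.1 == u) || (e.2 == u))%:R
   else - ((e == (u, v)) || (e == (v, u)))%:R.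
transitivity (\sum_v \sum_(e <- edges G) l e v * x v 0).
  apply: eq_bigr => v _; rewrite mxE -mulr_suml; congr (_ * _).
  rewrite /l /degree /edge_mult !count_sumr.
  by case: eqP => // _; rewrite sumrN.
rewrite exchange_big /=; apply: eq_big_seq => -[a b] /edge_neq /= Hab.
(* For a fixed edge, only the columns of its two ends contribute. *)
rewrite (bigD1 a) //= (bigD1 b) 1?eq_sym //= big1 ?addr0; last first.
  move=> v /andP[Ha Hb]; rewrite /l /=.
  case: eqP => [Hu|_].
    by subst v; rewrite ![_ == u]eq_sym (negPf Ha) (negPf Hb) mul0r.
  by rewrite !xpair_eqE ![_ == v]eq_sym (negPf Ha) (negPf Hb) /= !andbF oppr0 mul0r.
rewrite /l /= !xpair_eqE !eqxx /=.
have Hba : (b == a) = false by rewrite eq_sym (negPf Hab).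
case: (eqVneq u a) => [->|Ha].
  by rewrite Hba (negPf Hab) /=; ring.
case: (eqVneq u b) => [E|Hb].
  by rewrite ?Hba ?(negPf Hab) ?eqxx /=; ring.
by rewrite /= ?andbF /=; ring.
Qed.

Lemma lapB (x y : V -> int) u : lap (fun v => x v - y v) u = lap x u - lap y u.
Proof. by rewrite /lap -sumrB; apply: eq_bigr => e _; ring. Qed.

(** A discrete divergence theorem: only edges with exactly one end in [W] survive. *)
Lemma sum_lap (W : {set V}) (x : V -> int) :
  \sum_(u in W) lap x u =
  \sum_(e <- edges G) ((e.1 \in W)%:R - (e.2 \in W)%:R) * (x e.1 - x e.2).
Proof.
rewrite exchange_big /=; apply: eq_bigr => e _; rewrite big_split /= -!mulr_suml.
have S a : \sum_(u in W) ((a == u)%:R : int) = (a \in W)%:R.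
  case: (boolP (a \in W)) => Ha.
    rewrite (bigD1 a) //= eqxx big1 ?addr0 // => u /andP[_ Hu].
    by rewrite eq_sym (negPf Hu).
  by apply: big1 => u Hu; case: eqP => // E; rewrite E Hu in Ha.
by rewrite !S; ring.
Qed.

(** What [u] in [U] sends away when [U] is fired; a vertex outside [U] then receives
    [out (~: U) u]. *)
Definition out (U : {set V}) (u : V) : nat :=
  count (fun e => ((e.1 == u) && (e.2 \notin U)) || ((e.2 == u) && (e.1 \notin U)))
    (edges G).

Definition ind (U : {set V}) (u : V) : int := (u \in U)%:R.

Lemma lap_ind (U : {set V}) u :
  lap (ind U) u = if u \in U then (out U u)%:Z else - (out (~: U) u)%:Z.
Proof.
rewrite /out !count_sumr -sumrN /lap.
case: ifP => Hu; apply: eq_big_seq => -[a b] /edge_neq /= Hab; rewrite /ind ?in_setC ?negbK.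
- case: (eqVneq a u) => [E|Ha].
    subst a; rewrite (eq_sym b u) (negPf Hab) Hu /=.
    by case: (b \in U); rewrite ?mul0r ?addr0 ?mul1r.
  case: (eqVneq b u) => [E|Hb] /=; last by rewrite !mul0r.
  by subst b; rewrite Hu /=; case: (a \in U); rewrite ?mul0r ?add0r ?mul1r.
- case: (eqVneq a u) => [E|Ha].
    subst a; rewrite (eq_sym b u) (negPf Hab) Hu /=.
    by case: (b \in U); rewrite ?mul0r ?addr0 ?mul1r ?sub0r.
  case: (eqVneq b u) => [E|Hb] /=; last by rewrite !mul0r addr0 oppr0.
  by subst b; rewrite Hu /=; case: (a \in U); rewrite ?mul0r ?add0r ?mul1r ?sub0r.
Qed.

Lemma out_gt0 (U : {set V}) u v : adjacent u v -> v \notin U -> (0 < out U u)%N.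
Proof.
case/adjacentP => e He H Hv; rewrite /out -has_count; apply/hasP; exists e => //.
by case: H => -> /=; rewrite eqxx Hv ?orbT.
Qed.

Lemma out_gt0P (U : {set V}) u : (0 < out U u)%N -> exists2 v, adjacent u v & v \notin U.
Proof.
rewrite /out -has_count => /hasP[[a b] He /= /orP[] /andP[/eqP E H]]; subst.
- by exists b => //; apply/adjacentP; exists (u, b); auto.
- by exists a => //; apply/adjacentP; exists (a, u); auto.
Qed.

Lemma out_le (U W : {set V}) u : U \subset W -> (out W u <= out U u)%N.
Proof.
move=> /subsetP H; apply: sub_count => e /= /orP[] /andP[-> Hn]; apply/orP; [left|right];
  by apply: contra Hn; apply: H.
Qed.

Lemma card_neighbours_out (U : {set V}) u :
  (#|[set y | adjacent u y && (y \notin U)]| <= out U u)%N.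
Proof.
rewrite /out -size_filter.
set s := filter _ _.
pose g (e : V * V) := if e.1 == u then e.2 else e.1.
rewrite -(size_map g); apply: leq_trans (card_size (map g s)).
apply: subset_leq_card; apply/subsetP => y; rewrite inE => /andP[/adjacentP[e He H] Hy].
apply/mapP; exists e; rewrite ?mem_filter /g.
  by rewrite He andbT; case: H => -> /=; rewrite eqxx Hy ?orbT.
by case: H => E; rewrite E /= ?eqxx //; case: eqP => // Eu.
Qed.

Definition legal (D : {ffun V -> nat}) (U : {set V}) : bool :=
  [forall u in U, out U u <= D u]%N.

Lemma legalP (D : {ffun V -> nat}) (U : {set V}) :
  reflect (forall u, u \in U -> (out U u <= D u)%N) (legal D U).
Proof. exact: forall_inP. Qed.

(** Enlarging a set leaves fewer edges out of it. Closure under union is what gives a largest legal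
    set avoiding a vertex. *)
Lemma legalU D U W : legal D U -> legal D W -> legal D (U :|: W).
Proof.
move=> /legalP HU /legalP HW; apply/legalP => u /setUP[] Hu.
- exact: leq_trans (out_le _ (subsetUl _ _)) (HU _ Hu).
- exact: leq_trans (out_le _ (subsetUr _ _)) (HW _ Hu).
Qed.

Definition max_legal (D : {ffun V -> nat}) (v : V) : {set V} :=
  \bigcup_(U : {set V} | legal D U && (v \notin U)) U.

Lemma max_legalP D v : legal D (max_legal D v) && (v \notin max_legal D v).
Proof.
rewrite /max_legal; elim/big_ind: _ => [|U W /andP[H1 H2] /andP[H3 H4]|//].
  by rewrite in_set0 andbT; apply/legalP => u; rewrite in_set0.
by rewrite legalU // in_setU negb_or H2.
Qed.

Lemma max_legal_sup D v U : legal D U -> v \notin U -> U \subset max_legal D v.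
Proof. by move=> H1 H2; apply: bigcup_sup; rewrite H1. Qed.

(** A legal set avoiding [v] also avoids its chipless neighbour [w], which would have to send a chip
    to [v]; the roles are symmetric. *)
Lemma max_legal_adjacent D v w : adjacent v w -> D v = 0%N -> D w = 0%N ->
  max_legal D v = max_legal D w.
Proof.
have H v' w' : adjacent v' w' -> D w' = 0%N -> max_legal D v' \subset max_legal D w'.
  move=> Ha Hw; have /andP[Hl Hv] := max_legalP D v'.
  apply: max_legal_sup => //; apply/negP => Hin.
  have := legalP _ _ Hl _ Hin; rewrite Hw.
  by have := @out_gt0 (max_legal D v') w' v'; rewrite adjacent_sym => /(_ Ha Hv); lia.
move=> Ha Hv Hw; apply/eqP; rewrite eqEsubset !H //.
by rewrite adjacent_sym.
Qed.

Definition fire_set (D : {ffun V -> nat}) (U : {set V}) : {ffun V -> nat} :=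
  [ffun u => if u \in U then (D u - out U u)%N else (D u + out (~: U) u)%N].

Lemma fire_setE D U u : legal D U -> (fire_set D U u)%:Z = (D u)%:Z - lap (ind U) u.
Proof.
move=> /legalP H; rewrite ffunE lap_ind; case: ifP => Hu.
  by rewrite -subzn ?H.
by rewrite opprK PoszD.
Qed.

Definition deg (D : {ffun V -> nat}) : nat := \sum_u D u.

Lemma sum_lap0 x : \sum_u lap x u = 0.
Proof.
have -> : \sum_u lap x u = \sum_(u in [set: V]) lap x u.
  by apply: eq_bigl => u; rewrite inE.
rewrite sum_lap; apply: big1 => e _.
by rewrite !in_setT subrr mul0r.
Qed.

Lemma Posz_deg D : (deg D)%:Z = \sum_u (D u)%:Z.
Proof. exact: (big_morph Posz PoszD (erefl 0%:Z)). Qed.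

Lemma deg_equiv (D F : {ffun V -> nat}) x :
  (forall u, (F u)%:Z = (D u)%:Z - lap x u) -> deg F = deg D.
Proof.
move=> H; apply/eqP; rewrite -eqz_nat !Posz_deg; apply/eqP.
under eq_bigr do rewrite H.
by rewrite sumrB sum_lap0 subr0.
Qed.

Lemma deg_fire D U : legal D U -> deg (fire_set D U) = deg D.
Proof. by move=> H; apply: (@deg_equiv _ _ (ind U)) => u; apply: fire_setE. Qed.

Lemma le_deg D u : (D u <= deg D)%N.
Proof. by rewrite /deg (bigD1 u) //= leq_addr. Qed.

(* Summing over the superlevel set of [x] at [a], every edge leaving the set
   contributes positively and the edge from [a] to [b] contributes
   [x a - x b]. *)
Lemma edge_slope (D F : {ffun V -> nat}) x a b :
  (forall u, (F u)%:Z = (D u)%:Z - lap x u) -> adjacent a b ->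
  x a - x b <= (deg D)%:Z.
Proof.
move=> H Hab; have [//|Hlt] := lerP (x a - x b) 0; first by move/le_trans; apply.
pose W := [set u | x a <= x u].
have Ha : a \in W by rewrite inE.
have Hb : b \notin W by rewrite inE -ltNge; lia.
have : \sum_(u in W) lap x u <= (deg D)%:Z.
  have -> : \sum_(u in W) lap x u = \sum_(u in W) (D u)%:Z - \sum_(u in W) (F u)%:Z.
    by rewrite -sumrB; apply: eq_bigr => u _; rewrite H; ring.
  rewrite lerBlDr -[leLHS]addr0; apply: lerD; last by apply: sumr_ge0.
  rewrite Posz_deg [leRHS](bigID (mem W)) /= lerDl.
  by apply: sumr_ge0.
apply: le_trans; rewrite sum_lap.
have [e He Hor] := adjacentP _ _ Hab.
have pos (f : V * V) : 0 <= ((f.1 \in W)%:R - (f.2 \in W)%:R) * (x f.1 - x f.2).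
  rewrite !inE; case: (lerP (x a) (x f.1)); case: (lerP (x a) (x f.2)) => /= *;
    rewrite ?subrr ?mul0r //; nia.
rewrite (big_rem e) //= -[leLHS]addr0; apply: lerD; last exact: sumr_ge0.
by case: Hor => -> /=; rewrite Ha (negPf Hb) /=; lia.
Qed.

(** Sum [edge_slope] along a simple path. *)
Lemma potential_bound (D F : {ffun V -> nat}) x :
  connected G -> (forall u, (F u)%:Z = (D u)%:Z - lap x u) ->
  forall a b, x a - x b <= (nverts G * deg D)%:Z.
Proof.
move=> [_ Hc] H a b; have /connectP[p0 Hp0 ->] := Hc a b.
case/shortenP: Hp0 => p Hp Hu _.
have Hs : (size p <= nverts G)%N.
  have := max_card (mem (a :: p)); rewrite (card_uniqP Hu) card_ord /=; lia.
apply: (@le_trans _ _ (size p * deg D)%:Z); last by rewrite lez_nat leq_mul2r Hs orbT.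
elim: p a Hp {Hu Hs} => [|c p IH] a /=; first by rewrite subrr.
case/andP=> Hac Hp; rewrite mulSn PoszD -(subrKA (x c)).
exact: lerD (edge_slope H Hac) (IH _ Hp).
Qed.

Definition step_to (v : V) (D : {ffun V -> nat}) : {ffun V -> nat} :=
  if (0 < D v)%N then D else fire_set D (max_legal D v).

Definition pursue (D : {ffun V -> nat}) (v : V) (r : nat) : {ffun V -> nat} :=
  iter r (step_to v) D.

Lemma deg_pursue D v r : deg (pursue D v r) = deg D.
Proof.
elim: r => //= r IH; rewrite /step_to; case: ifP => _ //.
by rewrite deg_fire //; case/andP: (max_legalP (pursue D v r) v).
Qed.

(* The set where [x] is maximal is legal, hence contained in the fired set, so
   firing lowers the maximum of [x] while leaving [x v] unchanged. *)
Lemma pursue_hits (F : {ffun V -> nat}) v (R : nat) D x :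
  (forall u, (F u)%:Z = (D u)%:Z - lap x u) -> (0 < F v)%N ->
  (forall u, x u - x v <= R%:Z) ->
  exists2 r, (r <= R)%N & (0 < pursue D v r v)%N.
Proof.
move=> H HF; elim: R D x H => [|R IH] D x H Hx.
  exists 0%N => //=; have : 0 <= lap x v.
    apply: sumr_ge0 => e _.
    have := Hx e.1; have := Hx e.2.
    by case: eqP => [->|_]; case: eqP => [->|_]; rewrite ?mul0r ?mul1r; lia.
  by have := H v; lia.
case: (posnP (D v)) => HD; last by exists 0%N.
pose top := [set u | x u - x v == R.+1%:Z].
have Htop : legal D top.
  apply/legalP => u; rewrite inE => /eqP Hu.
  (* No neighbour of [u] is higher, and [x] drops by at least one along each edge leaving [top]. *)
  have Hout : (out top u)%:Z <= lap x u.
    rewrite /out count_sumr /lap big_seq [leRHS]big_seq.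
    apply: ler_sum => -[a b] /edge_neq /= Hab.
    have := Hx a; have := Hx b; rewrite !inE.
    case: (eqVneq a u) => [Ea|_]; case: (eqVneq b u) => [Eb|_];
      subst; rewrite ?eqxx // in Hab *;
      rewrite /= ?mul0r ?mul1r ?addr0 ?add0r //; case: eqP => /= *; lia.
  by have := H u; lia.
have Hvtop : v \notin top by rewrite inE subrr.
have /andP[Hl Hv] := max_legalP D v.
have /subsetP Hsub := max_legal_sup Htop Hvtop.
have [||r Hr Hpos] := IH (fire_set D (max_legal D v)) (fun u => x u - ind (max_legal D v) u).
- by move=> u; rewrite lapB fire_setE // H; ring.
- move=> u; rewrite {2}/ind (negPf Hv) subr0.
  have := Hx u; rewrite /ind; case: (boolP (u \in _)) => Hu /=; first by lia.
  by have := contra (Hsub u) Hu; rewrite inE; lia.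
exists r.+1 => //; rewrite /pursue iterSr.
by rewrite /step_to HD.
Qed.

Lemma rank_pursue_hits (D : {ffun V -> nat}) (v : V) :
  connected G -> rank_ge1 (\col_u (D u)%:Z : divisor G) ->
  exists2 r, (r <= nverts G * deg D)%N & (0 < pursue D v r v)%N.
Proof.
move=> Hc [_ /(_ v) [D' [x Hx] Heff]].
pose y u : int := x u 0.
(* Putting back the chip removed from [v] gives an effective divisor equivalent to [D] with a chip
   on [v]. *)
pose F : {ffun V -> nat} := [ffun u => (absz (D' u 0%R) + (u == v))%N].
have HF u : (F u)%:Z = (D u)%:Z - lap y u.
  rewrite ffunE PoszD gez0_abs ?Heff // Hx !mxE -laplacian_lap mxE /= eqxx andbT.
  by case: (u == v) => /=; ring.
apply: (@pursue_hits F v _ D y) => //; first by rewrite ffunE eqxx addn1.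
by move=> u; apply: potential_bound.
Qed.

Lemma pursue_adjacent D v w t : adjacent v w ->
  (forall r, (r < t)%N -> pursue D v r v = 0%N) ->
  (forall r, (r < t)%N -> pursue D w r w = 0%N) ->
  forall r, (r <= t)%N -> pursue D v r = pursue D w r.
Proof.
move=> Ha Hv Hw; elim=> // r IH Hr.
have E := IH (ltnW Hr).
rewrite /pursue !iterS -!/(pursue _ _ _) /step_to Hv // Hw //= -E.
by rewrite (@max_legal_adjacent _ v w) // ?Hv // E Hw.
Qed.

End ChipFiring.

(** * Width of the bags *)

Section Width.
Variables (G : multigraph) (D : {ffun vertex G -> nat}) (h s : vertex G -> nat).
Notation V := (vertex G).
Implicit Types u v w y : V.

Hypothesis hP : forall v r, (pursue D v r v == 0) = (r < h v).
Hypothesis sP : forall v, 0 < h v ->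
  exists u, [/\ u = s v :> nat, u \in max_legal (pursue D v (h v).-1) v, adjacent u v
    & forall u', u' \in max_legal (pursue D v (h v).-1) v -> adjacent u' v -> s v <= u'].

Definition earlier u v : bool :=
  (h u < h v) || ((h u == h v) && ((s u < s v) || ((s u == s v) && (u < v)))).

Definition tail v : rel V := [rel a b | adjacent a b && ~~ earlier b v].

Lemma earlier_irr v : ~~ earlier v v.
Proof. by rewrite /earlier !ltnn !eqxx. Qed.

Lemma not_earlier_h w v : ~~ earlier w v -> h v <= h w.
Proof. by rewrite /earlier; lia. Qed.

(** Vertices that are not earlier than [v] are chipless in their own pursuits before round [h v], so
    [pursue_adjacent] applies along each edge of the path. *)
Lemma tail_pursue v w : connect (tail v) v w ->
  ~~ earlier w v /\ forall r, r <= h v -> pursue D w r = pursue D v r.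
Proof.
case/connectP => p; elim/last_ind: p w => [|p a IH] w /=.
  by move=> _ ->; split=> //; exact: earlier_irr.
rewrite rcons_path last_rcons => /andP[Hp /andP[Hadj Ha]] ->.
have [Hb E] := IH _ Hp erefl; split=> // r Hr.
have Hz u : ~~ earlier u v -> forall r, r < h v -> pursue D u r u = 0.
  move=> /not_earlier_h Hu r' Hr'; apply/eqP; rewrite hP; lia.
rewrite -(E r Hr); symmetry; apply: (@pursue_adjacent _ _ _ _ (h v)) => //; exact: Hz.
Qed.

Lemma pursueS v r : r < h v ->
  pursue D v r.+1 = fire_set (pursue D v r) (max_legal (pursue D v r) v).
Proof.
by move=> Hr; rewrite /pursue iterS -/(pursue D v r) /step_to lt0n hP Hr.
Qed.

(* As long as [w] has no chip, its neighbour [y] cannot fire and so keeps its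
   chips. *)
Lemma keeps_chips w y r t : adjacent y w -> r <= t -> t < h w ->
  0 < pursue D w r y -> 0 < pursue D w t y.
Proof.
move=> Ha /subnKC <-; elim: (t - r) => [|d IH]; first by rewrite addn0.
move=> Hd Hy; rewrite addnS in Hd *.
have {IH} := IH (ltnW Hd) Hy; rewrite (pursueS (ltnW Hd)).
set D' := pursue D w (r + d); set U := max_legal D' w => Hpos.
rewrite ffunE; case: ifP => HyU; last by lia.
have /andP[_ HwU] := max_legalP D' w.
have : pursue D w (r + d).+1 w == 0 by rewrite hP.
rewrite (pursueS (ltnW Hd)) -/D' -/U ffunE (negPf HwU).
have := @out_gt0 _ (~: U) w y; rewrite adjacent_sym in_setC HyU => /(_ Ha isT).
by lia.
Qed.

Lemma gets_chip w y r : r < h w -> adjacent y w ->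
  y \in max_legal (pursue D w r) w -> h w = r.+1.
Proof.
move=> Hr Ha Hy; have /andP[_ Hw] := max_legalP (pursue D w r) w.
have : 0 < pursue D w r.+1 w.
  rewrite (pursueS Hr) ffunE (negPf Hw).
  have := @out_gt0 _ (~: max_legal (pursue D w r) w) w y.
  by rewrite adjacent_sym in_setC Hy => /(_ Ha isT); lia.
by rewrite lt0n hP -leqNgt; lia.
Qed.

Lemma bag_size v (B : {set V}) :
  (forall y, y \in B -> y = v \/
     earlier y v /\ exists2 w, adjacent y w & connect (tail v) v w) ->
  #|B| <= (deg D).+1.
Proof.
move=> HB; case: (posnP (h v)) => Hv.
  (* In round 0 every member of the bag already carries a chip of [D]. *)
  apply: (@leq_trans #|[set y | 0 < D y]|).
    apply: subset_leq_card; apply/subsetP => y /HB Hy; rewrite inE lt0n.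
    have -> : (D y == 0) = (0 < h y) by rewrite -(hP y 0).
    by case: Hy => [->|[]]; [lia | rewrite /earlier; lia].
  rewrite -sum1_card /deg big_mkcond /=; apply: leqW; apply: leq_sum => y _.
  by rewrite inE; case: ifP.
have [j [Ej HjU Hjv Hmin]] := sP Hv.
set D' := pursue D v (h v).-1 in HjU Hmin; set U := max_legal D' v in HjU Hmin.
have Hv1 : (h v).-1 < h v by lia.
have /andP[Hlegal HvU] := max_legalP D' v.
have HD'v : D' v = 0 by apply/eqP; rewrite hP.
(* [Z] contains [v] and the members hit in this round, [Y1] the fired members, [Y2] the unfired ones
   with chips. All are counted in [D'], the divisor just before [v] is hit. *)
pose Z := [set y | (y \notin U) && [exists u in U, (u <= j) && adjacent u y]].
pose Y1 := [set y in U | (j <= y) && (0 < D' y)].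
pose Y2 := [set y | (y \notin U) && (0 < D' y)].
have Hsub : B \subset Z :|: (Y1 :|: Y2).
  apply/subsetP => y /HB [->|[Hyv [w Hyw Hvw]]].
    rewrite !inE HvU /=; apply/orP; left; apply/exists_inP; exists j => //.
    by rewrite leqnn.
  have [Hw Ew] := tail_pursue Hvw; have Hhw := not_earlier_h Hw.
  have EwD : pursue D w (h v).-1 = D' by apply: Ew; lia.
  have Hw0 : D' w = 0 by rewrite -EwD; apply/eqP; rewrite hP; lia.
  (* The path from [v] to [w] consists of vertices chipless in [D'], so the largest legal set does
     not change along it. *)
  have EU : max_legal D' w = U.
    have : forall p, path (tail v) v p -> max_legal D' (last v p) = U.
      elim/last_ind => [|p a IH] //; rewrite rcons_path last_rcons => /andP[Hp /andP[Ha Hn]].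
      rewrite -(IH Hp); symmetry; apply: max_legal_adjacent => //.
        have [Hl El] : ~~ earlier (last v p) v /\ forall r, r <= h v -> pursue D (last v p) r = pursue D v r.
          by apply: tail_pursue; apply/connectP; exists p.
        have := not_earlier_h Hl => Hhl; rewrite /D' -El; last by lia.
        by apply/eqP; rewrite hP; lia.
      have [Hl El] : ~~ earlier a v /\ forall r, r <= h v -> pursue D a r = pursue D v r.
        apply: tail_pursue; apply/connectP; exists (rcons p a); last by rewrite last_rcons.
        by rewrite rcons_path Hp andTb; apply/andP; split.
      have := not_earlier_h Hl => Hhl; rewrite /D' -El; last by lia.
      by apply/eqP; rewrite hP; lia.
    by case/connectP: Hvw => p Hp ->; apply.
  case: (boolP (y \in U)) => HyU.
    have Hw1 : (h v).-1 < h w by lia.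
    (* Firing [y] hits [w] in this very round. As [w] is not earlier than [v], the tie-break gives
       [s v <= s w <= y]. *)
    have Eh : h w = h v by rewrite (gets_chip Hw1 Hyw) ?EwD ?EU //; lia.
    have Hpos : 0 < D' y.
      have /andP[_ HwU] := max_legalP D' w; rewrite EU in HwU.
      exact: leq_trans (out_gt0 Hyw HwU) (legalP _ _ Hlegal _ HyU).
    have Hsw : s v <= s w by move: Hw; rewrite /earlier Eh ltnn eqxx /=; lia.
    have [_ [_ _ _ Hminw]] := sP (leq_trans Hv Hhw).
    have Hswy : s w <= y by apply: Hminw => //; rewrite Eh EwD EU.
    have Hjy : j <= y by rewrite Ej; lia.
    by rewrite !inE HyU Hjy Hpos orbT.
  case: (posnP (D' y)) => Hy0; last by rewrite !inE HyU Hy0 !orbT.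
  have Hhy : h y <= h v by move: Hyv; rewrite /earlier; lia.
  (* Had [y] been hit before, it would have kept a chip up to [D'], by [keeps_chips] for its
     neighbour [w]. *)
  have Ehy : h y = h v.
    apply/eqP; rewrite eqn_leq Hhy leqNgt; apply/negP => Hlt.
    have E : pursue D y (h y) = pursue D w (h y).
      apply: (@pursue_adjacent _ _ _ _ (h y)) => // r Hr; apply/eqP; rewrite hP; lia.
    have : 0 < pursue D w (h y) y by rewrite -E lt0n hP ltnn.
    move/(keeps_chips Hyw (t := (h v).-1)); rewrite EwD Hy0 => H.
    by have : false by apply: H; lia.
  have EyD : pursue D y (h v).-1 = D'.
    rewrite -EwD; apply: (@pursue_adjacent _ _ _ _ (h v).-1) => // r Hr; apply/eqP;
      rewrite hP; lia.
  have EyU : max_legal D' y = U by rewrite -EU; apply: max_legal_adjacent.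
  have Hy1 : 0 < h y by lia.
  have [u [Eu HuU Huy _]] := sP Hy1; rewrite Ehy EyD EyU in HuU.
  rewrite !inE HyU /=; apply/orP; left; apply/exists_inP; exists u => //.
  rewrite Huy andbT Eu Ej.
  by move: Hyv; rewrite /earlier Ehy ltnn eqxx /=; lia.
apply: leq_trans (subset_leq_card Hsub) _.
apply: leq_trans (leq_card_setU _ _) _.
have HY12 := leq_card_setU Y1 Y2.
have HZ : #|Z| <= \sum_(u in U | u <= j) D' u.
  apply: (@leq_trans #|\bigcup_(u in U | u <= j) [set y | adjacent u y && (y \notin U)]|).
    apply: subset_leq_card; apply/subsetP => y; rewrite inE => /andP[HyU /exists_inP[u Hu /andP[Huj Ha]]].
    by apply/bigcupP; exists u; rewrite ?Hu // inE Ha.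
  apply: (@leq_trans (\sum_(u in U | u <= j) #|[set y | adjacent u y && (y \notin U)]|)).
    elim/big_ind2: _ => [|A a A' a' H H'|//]; first by rewrite cards0.
    by apply: leq_trans (leq_card_setU _ _) _; apply: leq_add.
  apply: leq_sum => u /andP[Hu _].
  exact: leq_trans (card_neighbours_out _ _) (legalP _ _ Hlegal _ Hu).
(* The 1 is [j] itself, whose chips are already spent on [Z]. *)
have HY1 : #|Y1| <= 1 + \sum_(u in U | ~~ (u <= j)) D' u.
  rewrite (cardsD1 j Y1); apply: leq_add; first by case: (_ \in _).
  rewrite -sum1_card big_mkcond [X in _ <= X]big_mkcond /=; apply: leq_sum => u _.
  rewrite !inE; case: eqP => //= Huj; case: (u \in U) => //=; rewrite -ltnNge.
  case: (ltnP j u) => Hu /=; first by case: ifP => //; lia.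
  case: ifP => // /andP[Hju _]; case: Huj; apply: val_inj => /=; lia.
have HY2 : #|Y2| <= \sum_(u | u \notin U) D' u.
  rewrite -sum1_card big_mkcond [X in _ <= X]big_mkcond /=; apply: leq_sum => u _.
  by rewrite !inE; case: (u \in U) => //=; case: ifP.
have : deg D = \sum_(u in U | u <= j) D' u + \sum_(u in U | ~~ (u <= j)) D' u
   + \sum_(u | u \notin U) D' u.
  rewrite -(deg_pursue D v (h v).-1) -/D' /deg (bigID (mem U)) /=; congr (_ + _).
  by rewrite (bigID (fun u : V => u <= j)).
move=> ->; apply: leq_trans (leq_add HZ (leq_trans HY12 (leq_add HY1 HY2))) _.
by rewrite -!addnA addnCA add1n.
Qed.

End Width.

(** * Tree decompositions from vertex orders *)

Section OrderDecomposition.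
Variables (G : multigraph) (bef : rel (vertex G)).
Notation V := (vertex G).
Implicit Types u v w y : V.

Hypothesis bef_irr : irreflexive bef.
Hypothesis bef_trans : transitive bef.
Hypothesis bef_total : forall u v, u != v -> bef u v || bef v u.

Definition not_before v : rel V := [rel a b | adjacent a b && ~~ bef b v].

Definition obag v : {set V} :=
  [set y | (y == v) || (bef y v && [exists w, adjacent y w && connect (not_before v) v w])].

Definition has_before v : bool := [exists y, bef y v].

Variable p : V -> V.
Hypothesis p_before : forall v, has_before v -> bef (p v) v.
Hypothesis p_last : forall v y, y \in obag v -> y != v ->
  [/\ p v \in obag v, p v != v & ~~ bef (p v) y].

Definition oedges : seq (V * V) := [seq (v, p v) | v <- enum 'I_(nverts G) & has_before v].

Lemma bef_neq u v : bef u v -> u != v.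
Proof. by move=> H; apply/eqP => E; rewrite E bef_irr in H. Qed.

Lemma oedges_neq : all (fun e => e.1 != e.2) oedges.
Proof.
apply/allP => e /mapP[v]; rewrite mem_filter => /andP[/p_before Hv _] -> /=.
by rewrite eq_sym bef_neq.
Qed.

Definition otree : multigraph := Multigraph oedges_neq.

Lemma mem_oedges u v : ((u, v) \in oedges) = has_before u && (p u == v).
Proof.
apply/mapP/andP => [[w]|[Hu /eqP <-]].
  by rewrite mem_filter => /andP[Hw _] [-> ->].
by exists u => //; rewrite mem_filter Hu mem_enum.
Qed.

Lemma oadjacentE u v : @adjacent otree u v =
  (has_before u && (p u == v)) || (has_before v && (p v == u)).
Proof.
apply/adjacentP/orP => /= [[e He [Ee|Ee]]|[]]; rewrite -?mem_oedges.
- by subst e; left.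
- by subst e; right.
- by move=> He; exists (u, v); auto.
- by move=> He; exists (v, u); auto.
Qed.

Lemma uniq_oedges : uniq oedges.
Proof.
rewrite map_inj_uniq; last by move=> u v [].
by rewrite filter_uniq ?enum_uniq.
Qed.

Lemma bef_asym u v : bef u v -> bef v u = false.
Proof. by move=> H; apply/negP => /(bef_trans H); rewrite bef_irr. Qed.

Lemma count_le1 (T : eqType) (P : pred T) (s : seq T) e0 :
  uniq s -> (forall e, e \in s -> P e -> e = e0) -> count P s <= 1.
Proof.
move=> Hu H; apply: (@leq_trans (count (pred1 e0) s)); last first.
  by rewrite (count_uniq_mem _ Hu); case: (_ \in _).
rewrite -(@eq_in_count _ (predI P (mem s)) P); last first.
  by move=> e He /=; rewrite He andbT.
by apply: sub_count => e /= /andP[HP He]; rewrite (H e).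
Qed.

Lemma oedge_mult u v : @edge_mult otree u v <= 1.
Proof.
case: (boolP ((u, v) \in oedges)) => Huv.
  apply: (@count_le1 _ _ _ (u, v)) uniq_oedges _ => e He /orP[] /eqP // Ee; subst e.
  move: He Huv; rewrite !mem_oedges.
  move=> /andP[/p_before H1 /eqP E1] /andP[/p_before H2 /eqP E2].
  by move: H1 H2; rewrite E1 E2 => /bef_asym ->.
apply: (@count_le1 _ _ _ (v, u)) uniq_oedges _ => e He /orP[] /eqP // Ee; subst e.
by rewrite He in Huv.
Qed.

(** The position in the order, used as measure for climbing to the root and to choose extremal
    vertices. *)
Definition rk v : nat := #|[set y | bef y v]|.

Lemma rk_lt u v : bef u v -> rk u < rk v.
Proof.
move=> H; apply: proper_card; apply/properP; split.
  by apply/subsetP => y; rewrite !inE => /bef_trans; apply.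
by exists u; rewrite !inE // bef_irr.
Qed.

Lemma first_unique r r' : ~~ has_before r -> ~~ has_before r' -> r = r'.
Proof.
move=> /existsPn Hr /existsPn Hr'; apply/eqP; apply/negPn/negP => /bef_total.
by rewrite (negPf (Hr _)) (negPf (Hr' _)).
Qed.

Lemma otree_connected : 0 < nverts G -> connected otree.
Proof.
move=> Hn; split=> //.
have Hs : connect_sym (@adjacent otree) by apply: sym_connect_sym; exact: adjacent_sym.
have to_root v : exists2 r, ~~ has_before r & connect (@adjacent otree) v r.
  have [m] := ubnP (rk v); elim: m v => // m IH v Hm.
  case: (boolP (has_before v)) => Hv; last by exists v; rewrite ?connect0.
  have [r Hr Hc] := IH (p v) (leq_trans (rk_lt (p_before Hv)) Hm).
  exists r => //; apply: connect_trans Hc; apply: connect1.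
  by rewrite oadjacentE Hv eqxx.
move=> u v; have [r Hr Hu] := to_root u; have [r' Hr' Hv] := to_root v.
by apply: connect_trans Hu _; rewrite Hs (first_unique Hr Hr').
Qed.

(* The last vertex of a cycle would have two distinct parents. *)
Lemma otree_acyclic (c : seq (vertex otree)) : ucycle (@adjacent otree) c -> size c <= 2.
Proof.
case/andP=> Hc Hu; rewrite leqNgt; apply/negP => Hsize.
case: c Hc Hu Hsize => // x0 c0; set c := x0 :: c0 => Hc Hu Hsize.
have [x Hx Hmax] : exists2 x, x \in c & forall y, y \in c -> rk y <= rk x.
  by case: (@arg_maxnP _ x0 (mem c) rk (mem_head _ _)) => x; exists x.
have [i s Hrot] := rot_to Hx.
have Hc' : cycle (@adjacent otree) (x :: s) by rewrite -Hrot rot_cycle.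
have Hu' : uniq (x :: s) by rewrite -Hrot rot_uniq.
have Hs' : size (x :: s) = size c by rewrite -Hrot size_rot.
have adjp y : y \in s -> @adjacent otree x y -> y = p x.
  move=> Hy; rewrite oadjacentE => /orP[/andP[_ /eqP //]|/andP[/p_before + /eqP E]].
  rewrite E => /rk_lt; rewrite ltnNge Hmax // -(mem_rot i) Hrot inE Hy orbT //.
case: s Hrot Hc' Hu' Hs' adjp => [|y s] Hrot Hc' Hu' Hs' adjp.
  by rewrite -Hs' in Hsize.
case/lastP: s Hrot Hc' Hu' Hs' adjp => [|s z] Hrot Hc' Hu' Hs' adjp.
  by rewrite -Hs' in Hsize.
have Hy : y = p x.
  by apply: adjp; [rewrite mem_head | move: Hc' => /= /andP[]].
have Hz : z = p x.
  apply: adjp; first by rewrite inE mem_rcons mem_head orbT.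
  move: Hc'; rewrite /= rcons_path last_rcons => /and3P[_ _].
  by rewrite adjacent_sym.
by move: Hu'; rewrite /= Hy -Hz mem_rcons mem_head /= andbF.
Qed.

Lemma obag_self v : v \in obag v.
Proof. by rewrite inE eqxx. Qed.

Lemma connect_not_before_le i q a b : bef q i -> connect (not_before i) a b -> connect (not_before q) a b.
Proof.
move=> Hq; apply: connect_sub => c d /andP[Hcd Hd]; apply: connect1.
apply/andP; split=> //; apply: contra Hd => Hd; exact: bef_trans Hd Hq.
Qed.

(* The reverse of a path starting at [i] ends at [i], which is not before [i]. *)
Lemma connect_not_before_rev i a : connect (not_before i) i a -> connect (not_before i) a i.
Proof.
case/connectP => s; elim/last_ind: s a => [|s b IH] a /=; first by move=> _ ->.
rewrite rcons_path last_rcons => /andP[Hs /andP[Hab Hb]] ->.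
apply: connect_trans (IH _ Hs erefl); apply: connect1; apply/andP.
split; first by rewrite adjacent_sym.
case/lastP: s Hs {Hab IH} => [|s c]; first by rewrite bef_irr.
by rewrite rcons_path last_rcons => /andP[_ /andP[]].
Qed.

(** The component explored from [i] is adjacent to [p i] and contains no vertex before [p i], so it
    is also explored from [p i]. As [p i] is the latest earlier member, [v] is either [p i] or
    before it, and it touches that component. *)
Lemma obag_parent i v : v \in obag i -> v != i -> has_before i /\ v \in obag (p i).
Proof.
move=> Hv Hvi; have [Hp Hpi Hlast] := p_last Hv Hvi.
have /andP[Hbi /existsP[w /andP[Hvw Hw]]] :
    bef v i && [exists w, adjacent v w && connect (not_before i) i w].
  by move: Hv; rewrite inE (negPf Hvi).
split; first by apply/existsP; exists v.
have [->|Hvp] := eqVneq v (p i); first exact: obag_self.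
have Hbv : bef v (p i) by have := bef_total Hvp; rewrite (negPf Hlast) orbF.
have /andP[Hbp /existsP[w' /andP[Hpw' Hw']]] :
    bef (p i) i && [exists w, adjacent (p i) w && connect (not_before i) i w].
  by move: Hp; rewrite inE (negPf Hpi).
rewrite inE Hbv /=; apply/orP; right; apply/existsP; exists w; rewrite Hvw /=.
have lift a b : connect (not_before i) a b -> connect (not_before (p i)) a b.
  exact: connect_not_before_le.
have Hni : ~~ bef w' (p i).
  have : w' = i \/ ~~ bef w' i.
    case/connectP: Hw' => s; case/lastP: s => [|s c]; first by left.
    by rewrite rcons_path last_rcons => /andP[_ /andP[_ Hc]] ->; right.
  case=> [->|]; first by rewrite bef_asym.
  by apply: contra => H; apply: bef_trans H Hbp.
(* The path goes from [p i] to its neighbour [w'], back to [i], and on to the neighbour [w] of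
   [v]. *)
apply: connect_trans (connect_trans (lift _ _ (connect_not_before_rev Hw')) (lift _ _ Hw)).
by apply: connect1; apply/andP.
Qed.

Lemma otree_decomposition : 0 < nverts G ->
  @tree_decomposition G otree obag.
Proof.
move=> Hn; split.
- split; [exact: oedge_mult | exact: otree_connected | exact: otree_acyclic].
- apply/setP => v; rewrite in_setT; apply/bigcupP; exists v => //; exact: obag_self.
- case=> a b He.
  have Hab : adjacent a b by apply/adjacentP; exists (a, b); auto.
  have H u v : adjacent u v -> bef u v -> u \in obag v.
    move=> Huv Hb; rewrite inE Hb /=; apply/orP; right; apply/existsP; exists v.
    by rewrite Huv connect0.
  case/orP: (bef_total (edge_neq He)) => /= Hb.
    by exists b; rewrite obag_self H.
  by exists a; rewrite obag_self H // adjacent_sym.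
- move=> v.
  have memS i : (i \in [set i | v \in obag i]) = (v \in obag i) by rewrite in_set.
  have Hsym : connect_sym [rel a b | [&& @adjacent otree a b, a \in [set i | v \in obag i]
      & b \in [set i | v \in obag i]]].
    apply: sym_connect_sym => a b.
    by apply/idP/idP => /and3P[Hab Ha Hb]; apply/and3P; split; rewrite // adjacent_sym.
  (* Climbing from any bag that contains [v], by [obag_parent], stays within bags containing [v]
     until the bag of [v] itself is reached. *)
  have to_v i : v \in obag i -> connect [rel a b | [&& @adjacent otree a b,
      a \in [set i | v \in obag i] & b \in [set i | v \in obag i]]] i v.
    have [m] := ubnP (rk i); elim: m i => // m IH i Hm Hi.
    have [->|Hvi] := eqVneq i v; first exact: connect0.
    have [|Hb Hp] := obag_parent Hi; first by rewrite eq_sym.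
    apply: connect_trans (IH _ (leq_trans (rk_lt (p_before Hb)) Hm) Hp).
    apply: connect1; apply/and3P; split; rewrite ?memS //.
    by rewrite oadjacentE Hb eqxx.
  move=> i j; rewrite !memS => Hi Hj.
  by apply: connect_trans (to_v i Hi) _; rewrite Hsym; exact: to_v.
Qed.

End OrderDecomposition.

(** * Correctness of the algorithm *)

Lemma nth_tabulate (T : Type) (x0 : T) (F : nat -> T) n u :
  u < n -> nth x0 [seq F i | i <- iota 0 n] u = F u.
Proof. by move=> Hu; rewrite (nth_map 0) ?size_iota // nth_iota. Qed.

Lemma iter_stable (T : Type) (f : T -> T) (m : T -> nat) :
  (forall x, f x = x \/ m (f x) < m x) ->
  forall n x, m x <= n -> f (iter n f x) = iter n f x.
Proof.
move=> H; elim=> [|n IH] x Hx.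
  by case: (H x) => //=; lia.
rewrite iterSr; case: (H x) => [E|Hlt]; last by apply: IH; lia.
have F k : iter k f x = x by elim: k => //= k ->.
by rewrite E F.
Qed.

(** For a downward closed predicate, counting finds the threshold; [hit] and [spark] are both read
    off in this way. *)
Lemma count_initial (P : pred nat) r0 N :
  (forall r, P r.+1 -> P r) -> ~~ P r0 -> r0 < N ->
  forall r, P r = (r < count P (iota 0 N)).
Proof.
move=> HP Hr0 HN; have Hex : exists r, ~~ P r by exists r0.
have [m Hm Hmin] := ex_minnP Hex.
have E r : P r = (r < m).
  apply/idP/idP => [Hr|Hr]; last by apply/negPn/negP => /Hmin; lia.
  rewrite ltnNge; apply/negP => Hle; move: Hr; rewrite -(subnK Hle).
  by elim: (r - m) => [|d IH]; [rewrite add0n (negPf Hm) | rewrite addSn => /HP].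
have EN k : count P (iota 0 k) = minn k m.
  elim: k => [|k IH]; first by rewrite min0n.
  rewrite -addn1 iotaD count_cat IH /= E add0n addn0.
  by case: ltnP; lia.
by move=> r; rewrite EN E; have := Hmin _ Hr0; case: ltnP; lia.
Qed.

Section Correctness.
Variable G : multigraph.
Notation V := (vertex G).
Notation n := (nverts G).
Implicit Types u v w y : V.

Definition nat_edges : seq (nat * nat) := [seq (val e.1, val e.2) | e <- edges G].
Notation E := nat_edges.

Definition set_of (L : seq bool) : {set V} := [set u : V | nth false L u].
Definition fun_of (D : seq nat) : {ffun V -> nat} := [ffun u : V => nth 0 D u].

Lemma set_of_tabulate (F : nat -> bool) u :
  (u \in set_of [seq F i | i <- iota 0 n]) = F u.
Proof. by rewrite inE nth_tabulate. Qed.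

Lemma adjE u v : adj E u v = adjacent u v.
Proof.
rewrite /adj has_map /adjacent /= -has_count; apply: eq_has => -[a b] /=.
by rewrite !xpair_eqE.
Qed.

Lemma outsideE L u : outside E L u = out (set_of L) u.
Proof. by rewrite /outside count_map; apply: eq_count => -[a b] /=; rewrite !inE. Qed.

Lemma insideE L u : inside E L u = out (~: set_of L) u.
Proof.
by rewrite /inside count_map; apply: eq_count => -[a b] /=; rewrite !inE !negbK.
Qed.

Lemma has_iota (P : pred nat) : has P (iota 0 n) = [exists u : V, P u].
Proof.
apply/hasP/existsP => [[u]|[u Hu]].
  by rewrite mem_iota => /andP[_ Hu] HP; exists (Ordinal Hu).
by exists (val u); rewrite // mem_iota /= ltn_ord.
Qed.

Lemma set_of_prune D L : set_of (prune n E D L) =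
  [set u in set_of L | out (set_of L) u <= fun_of D u].
Proof.
by apply/setP => u; rewrite set_of_tabulate !inE ffunE outsideE.
Qed.

(** The limit of pruning is legal, being a fixed point. Conversely no vertex of a legal set avoiding
    [v] is ever pruned, because it has even fewer edges leaving a larger set. *)
Lemma set_of_dhar D v : set_of (dhar n E D v) = max_legal (fun_of D) v.
Proof.
pose f (U : {set V}) := [set u in U | out U u <= fun_of D u].
have Hsub U : f U \subset U by apply/subsetP => u; rewrite inE => /andP[].
set L0 := [seq ~~ (i == nat_of_ord v) | i <- iota 0 n].
have Eit k : set_of (iter k (prune n E D) L0) = iter k f (set_of L0).
  by elim: k => //= k IH; rewrite set_of_prune IH.
have Hfix : f (set_of (dhar n E D v)) = set_of (dhar n E D v).
  rewrite /dhar Eit; apply: (@iter_stable _ f (fun U : {set V} => #|U|)); last first.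
    by rewrite -[X in _ <= X]card_ord; exact: max_card.
  move=> U; case: (eqVneq (f U) U) => HU; [by left | right].
  by apply: proper_card; rewrite properEneq HU Hsub.
have Hv k : v \notin set_of (iter k (prune n E D) L0).
  elim: k => [|k IH] /=; first by rewrite set_of_tabulate eqxx.
  by rewrite set_of_prune inE (negPf IH).
apply/eqP; rewrite eqEsubset; apply/andP; split.
  apply: max_legal_sup; last exact: Hv.
  by apply/legalP => u; rewrite -{1}Hfix inE => /andP[].
have /andP[Hl Hvm] := max_legalP (fun_of D) v.
have H k : max_legal (fun_of D) v \subset set_of (iter k (prune n E D) L0).
  elim: k => [|k IH] /=.
    apply/subsetP => u Hu; rewrite set_of_tabulate.
    by apply/negP => /eqP/ord_inj Euv; move: Hvm; rewrite -{1}Euv Hu.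
  apply/subsetP => u Hu; rewrite set_of_prune inE (subsetP IH _ Hu).
  exact: leq_trans (out_le _ IH) (legalP _ _ Hl _ Hu).
exact: H.
Qed.

Lemma fun_of_advance D v : deg (fun_of D) <= n ->
  fun_of (advance n E v D) = step_to v (fun_of D).
Proof.
move=> Hdeg; rewrite /advance /step_to ffunE; case: ifP => // _.
have /andP[Hl _] := max_legalP (fun_of D) v.
have Hle u := le_deg (fire_set (fun_of D) (max_legal (fun_of D) v)) u.
apply/ffunP => u; rewrite [LHS]ffunE nth_tabulate //.
have := Hle u; rewrite deg_fire // ffunE -set_of_dhar inE ffunE outsideE insideE.
by move=> H; apply/minn_idPr; lia.
Qed.

Lemma fun_of_chips D v r : deg (fun_of D) <= n ->
  fun_of (chips n E D v r) = pursue (fun_of D) v r.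
Proof.
move=> Hdeg; elim: r => [//|r IH]; rewrite /chips iterS -/(chips n E D v r).
by rewrite fun_of_advance IH // deg_pursue.
Qed.

Section Keys.
Variable D : seq nat.
Hypothesis G_connected : connected G.
Hypothesis D_deg : deg (fun_of D) < n.
Hypothesis D_rank : rank_ge1 (\col_u (fun_of D u)%:Z : divisor G)%R.

Lemma hitP v r : (pursue (fun_of D) v r v == 0) = (r < hit n E D v).
Proof.
have Echips k : nth 0 (chips n E D v k) v = pursue (fun_of D) v k v.
  by rewrite -fun_of_chips ?ffunE // ltnW.
have -> : hit n E D v = count (fun r => pursue (fun_of D) v r v == 0) (iota 0 (n * n)).
  by apply: eq_count => k /=; rewrite Echips.
have [r0 Hr0 Hpos] := rank_pursue_hits v G_connected D_rank.
apply: (@count_initial (fun r => pursue (fun_of D) v r v == 0) r0).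
- move=> k; rewrite /pursue iterS -/(pursue (fun_of D) v k) /step_to.
  by case: ifP => //; lia.
- by rewrite -lt0n.
(* The strict bound on the degree places the hitting round within the [n * n] rounds examined. *)
- apply: leq_ltn_trans Hr0 _; rewrite ltn_pmul2l //.
  by case: G_connected.
Qed.

Lemma sparkP v : 0 < hit n E D v ->
  exists u, [/\ u = spark n E D v :> nat,
    u \in max_legal (pursue (fun_of D) v (hit n E D v).-1) v, adjacent u v
    & forall u', u' \in max_legal (pursue (fun_of D) v (hit n E D v).-1) v ->
        adjacent u' v -> spark n E D v <= u'].
Proof.
move=> Hh; set D' := pursue _ _ _; set U := max_legal D' v.
pose good u := (u \in U) && adjacent u v.
pose P i := ~~ [exists u : V, (u <= i) && good u].
have EP : spark n E D v = count P (iota 0 n).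
  apply: eq_count => i; rewrite /= has_iota; congr (~~ _); apply: eq_existsb => u.
  rewrite /good adjE /U /D' -fun_of_chips; last exact: ltnW.
  by rewrite -set_of_dhar inE.
(* The chip that [v] has after this round must have come from a fired neighbour. *)
have [u0 Hu0] : exists u0, good u0.
  have Hlt : (hit n E D v).-1 < hit n E D v by lia.
  have /andP[_ HvU] := max_legalP D' v.
  have : pursue (fun_of D) v (hit n E D v) v != 0 by rewrite hitP ltnn.
  rewrite -{1}(prednK Hh) (pursueS hitP Hlt) -/D' -/U ffunE (negPf HvU).
  have /eqP -> : D' v == 0 by rewrite hitP.
  rewrite add0n -lt0n => /out_gt0P[u Hvu]; rewrite in_setC negbK => Hu.
  by exists u; rewrite /good Hu adjacent_sym.
have HP r : P r = (r < spark n E D v).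
  rewrite EP; apply: (@count_initial P u0) => //.
  - move=> i; apply: contra => /existsP[u /andP[Hu Hg]]; apply/existsP; exists u.
    by rewrite Hg andbT leqW.
  - by rewrite negbK; apply/existsP; exists u0; rewrite leqnn.
have Hmin u : good u -> spark n E D v <= u.
  move=> Hg; rewrite leqNgt -HP negbK; apply/existsP; exists u.
  by rewrite leqnn.
have : ~~ P (spark n E D v) by rewrite HP ltnn.
rewrite negbK => /existsP[u /andP[Hle Hg]]; exists u.
have /andP[HuU Huv] := Hg; split=> //; last by move=> u' H1 H2; apply: Hmin; apply/andP.
by apply/eqP; rewrite eqn_leq Hle Hmin.
Qed.

End Keys.

Section Tree.
Variable K : seq (nat * nat).
Hypothesis n_gt0 : 0 < n.

Definition kfst (u : V) : nat := (nth (0, 0) K u).1.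
Definition ksnd (u : V) : nat := (nth (0, 0) K u).2.

(** Any list [K] gives a strict total order, the vertex number being the last tie-break. The tree
    decomposition is thus valid for all keys; the particular ones serve to bound its width. *)
Definition kbefore : rel V := fun u v => before K u v.

Lemma kbeforeE u v : kbefore u v = earlier kfst ksnd u v.
Proof. by []. Qed.

Lemma kbefore_irr : irreflexive kbefore.
Proof. by move=> u; rewrite kbeforeE /earlier !ltnn !eqxx. Qed.

Lemma kbefore_trans : transitive kbefore.
Proof. by move=> v u w; rewrite !kbeforeE /earlier; lia. Qed.

Lemma kbefore_total u v : u != v -> kbefore u v || kbefore v u.
Proof. by rewrite -val_eqE /= !kbeforeE /earlier; lia. Qed.

Lemma set_of_later v :
  set_of (later n E K v) = [set w | connect (not_before kbefore v) v w].
Proof.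
pose f (S : {set V}) :=
  [set u | (u \in S) || (~~ kbefore u v && [exists w, (w \in S) && adjacent w u])].
have Egrow L : set_of (grow n E K v L) = f (set_of L).
  apply/setP => u; rewrite set_of_tabulate !inE has_iota; congr (_ || (_ && _)).
  by apply: eq_existsb => w; rewrite inE adjE.
set L0 := [seq i == nat_of_ord v | i <- iota 0 n].
have Eit k : set_of (iter k (grow n E K v) L0) = iter k f (set_of L0).
  by elim: k => //= k IH; rewrite Egrow IH.
have E0 : set_of L0 = [set v] by apply/setP => u; rewrite set_of_tabulate inE.
have Hsup (S : {set V}) : S \subset f S by apply/subsetP => u; rewrite inE => ->.
have Hfix : f (set_of (later n E K v)) = set_of (later n E K v).
  rewrite /later Eit; apply: (@iter_stable _ f (fun U : {set V} => n - #|U|)); last by lia.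
  move=> S; case: (eqVneq (f S) S) => HS; [by left | right].
  have : S \proper f S by rewrite properEneq eq_sym HS Hsup.
  have Hle : #|f S| <= n by rewrite -[X in _ <= X]card_ord; exact: max_card.
  by move/proper_card => Hlt; apply: ltn_sub2l; first exact: leq_trans Hlt Hle.
have Hv k : v \in iter k f (set_of L0).
  by elim: k => [|k IH]; [rewrite E0 inE | apply: (subsetP (Hsup _))].
have Hc k w : w \in iter k f (set_of L0) -> connect (not_before kbefore v) v w.
  elim: k w => [|k IH] w; first by rewrite E0 inE => /eqP ->.
  rewrite iterS inE => /orP[|/andP[Hw /existsP[a /andP[Ha Haw]]]]; first exact: IH.
  by apply: connect_trans (IH _ Ha) _; apply: connect1; apply/andP.
apply/setP => w; rewrite [RHS]inE; apply/idP/idP; first by rewrite /later Eit; exact: Hc.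
case/connectP => s; elim/last_ind: s w => [|s b IH] w.
  by move=> _ /= ->; rewrite /later Eit.
rewrite rcons_path last_rcons => /andP[Hs /andP[Hab Hb]] ->.
rewrite -Hfix inE; apply/orP; right; rewrite Hb; apply/existsP.
by exists (last v s); rewrite Hab andbT; apply: IH.
Qed.

Lemma set_of_bag v : set_of (bag n E K v) = obag kbefore v.
Proof.
apply/setP => y; rewrite set_of_tabulate inE has_iota; congr (_ || (_ && _)).
apply: eq_existsb => w; rewrite adjE andbC; congr (_ && _).
by have := set_of_later v => /setP/(_ w); rewrite !inE.
Qed.

Lemma nonrootE v : nonroot n K v = has_before kbefore v.
Proof. exact: has_iota. Qed.

Lemma bag_restE v y : bag_rest n E K v y = (y != v) && (y \in obag kbefore v).
Proof. by rewrite /bag_rest -set_of_bag inE. Qed.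

Lemma parent_spec v : has_before kbefore v ->
  exists2 u : V, u = parent n E K v :> nat &
  kbefore u v /\ forall y, y \in obag kbefore v -> y != v ->
     [/\ u \in obag kbefore v, u != v & ~~ kbefore u y].
Proof.
move=> Hv; rewrite /parent.
set F := [seq y <- _ | _ & _].
have FP (u : V) : (val u \in F) = [&& u != v, u \in obag kbefore v &
    ~~ [exists z : V, [&& z != v, z \in obag kbefore v & kbefore u z]]].
  rewrite mem_filter mem_iota /= ltn_ord andbT bag_restE has_iota -andbA.
  congr [&& _, _ & ~~ _]; apply: eq_existsb => z.
  by rewrite bag_restE -andbA.
have Fn i : i \in F -> i < n by rewrite mem_filter mem_iota => /andP[_ /andP[]].
case EF : F => [|a s]; last first.
  have Ha : a \in F by rewrite EF mem_head.
  exists (Ordinal (Fn _ Ha)) => //; set u := Ordinal _.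
  have /and3P[H1 H2 H3] : [&& u != v, u \in obag kbefore v &
    ~~ [exists z : V, [&& z != v, z \in obag kbefore v & kbefore u z]]] by rewrite -FP.
  split; first by move: H2; rewrite inE (negPf H1) => /andP[].
  move=> y Hy Hyv; split=> //; apply: contra H3 => Hb; apply/existsP; exists y.
  by rewrite Hyv Hy.
(* If no candidate is listed, the bag is a singleton: otherwise its other member of largest rank
   would be listed. *)
have Hno y : y \in obag kbefore v -> y = v.
  move=> Hy; apply/eqP/negPn/negP => Hyv.
  pose R : pred V := fun z => (z != v) && (z \in obag kbefore v).
  have HR : R y by rewrite /R Hyv.
  case: (@arg_maxnP _ y R (rk kbefore) HR) => u /andP[Hu1 Hu2] Hmax.
  suff : val u \in F by rewrite EF.
  rewrite FP Hu1 Hu2; apply/existsPn => z; apply/negP => /and3P[Hz1 Hz2 Hz].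
  have := rk_lt kbefore_irr kbefore_trans Hz; rewrite ltnNge => /negP; apply.
  by apply: Hmax; rewrite /R Hz1.
have [r Hr] : exists r, ~~ has_before kbefore r.
  case: (@arg_minnP _ (Ordinal n_gt0) predT (rk kbefore) isT) => r _ Hmin; exists r.
  apply/existsPn => z; apply/negP => /(rk_lt kbefore_irr kbefore_trans).
  by rewrite ltnNge => /negP; apply; apply: Hmin.
set Q := [seq r <- _ | _].
have HrQ : val r \in Q by rewrite mem_filter mem_iota /= ltn_ord nonrootE Hr.
case EQ : Q HrQ => [//|a s] _ /=.
have : a \in Q by rewrite EQ mem_head.
rewrite mem_filter mem_iota /= => /andP[Ha Han].
exists (Ordinal Han) => //; set u := Ordinal _.
have {}Ha : ~~ has_before kbefore u by rewrite -nonrootE.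
split; last by move=> y /Hno ->; rewrite eqxx.
have Huv : u != v by apply: contra Ha => /eqP ->.
by have /orP[//|Hvu] := kbefore_total Huv; case/existsPn/(_ v)/negP: Ha.
Qed.

Definition tparent (v : V) : V := insubd v (parent n E K v).

Lemma tparent_val v : has_before kbefore v -> tparent v = parent n E K v :> nat.
Proof.
by move=> /parent_spec[u Eu _]; rewrite /tparent val_insubd -Eu ltn_ord.
Qed.

Lemma tparent_before v : has_before kbefore v -> kbefore (tparent v) v.
Proof.
move=> Hv; have [u Eu [Hu _]] := parent_spec Hv.
by have -> : tparent v = u by apply: val_inj; rewrite /= tparent_val.
Qed.

Lemma tparent_last v y : y \in obag kbefore v -> y != v ->
  [/\ tparent v \in obag kbefore v, tparent v != v & ~~ kbefore (tparent v) y].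
Proof.
move=> Hy Hyv; have Hv : has_before kbefore v.
  by apply/existsP; exists y; move: Hy; rewrite inE (negPf Hyv) => /andP[].
have [u Eu [_ H]] := parent_spec Hv.
have -> : tparent v = u by apply: val_inj; rewrite /= tparent_val.
exact: H.
Qed.

Definition dtree : multigraph := otree kbefore_irr tparent_before.

Lemma dtree_decomposition : @tree_decomposition G dtree (obag kbefore).
Proof.
apply: otree_decomposition n_gt0.
- exact: kbefore_trans.
- exact: kbefore_total.
- exact: tparent_last.
Qed.

Lemma decompositionE : decomposition n E K =
  graph_data dtree ++ flatten [seq [seq nat_of_bool (v \in obag kbefore i)
     | v <- enum 'I_n] | i <- enum 'I_n].
Proof.
have Eedges : tree_edges n E K = [seq (val e.1, val e.2) | e <- edges dtree].
  rewrite /tree_edges -val_enum_ord filter_map -!map_comp.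
  rewrite (eq_filter (_ : preim val (nonroot n K) =1 has_before kbefore)); last first.
    by move=> v; exact: nonrootE.
  apply/eq_in_map => v; rewrite mem_filter => /andP[Hv _] /=.
  by rewrite tparent_val.
have Ends : [seq [:: e.1; e.2] | e <- [seq (val e.1, val e.2) | e <- edges dtree]] =
    [seq [:: val e.1; val e.2] | e <- edges dtree] by rewrite -map_comp.
have Bags : [seq [seq nat_of_bool b | b <- bag n E K i] | i <- iota 0 n] =
    [seq [seq nat_of_bool (v \in obag kbefore i) | v <- enum 'I_n] | i <- enum 'I_n].
  rewrite -[in LHS]val_enum_ord -[LHS]map_comp; apply/eq_in_map => v _.
  rewrite /= /bag -[in LHS]val_enum_ord -[LHS]map_comp -[LHS]map_comp; apply/eq_in_map => y _.
  by rewrite /= val_enum_ord -set_of_bag set_of_tabulate.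
by rewrite /decomposition Eedges size_map Ends Bags.
Qed.

End Tree.

End Correctness.

(** * Encodings *)

Lemma count_ltn_iota m n : count (fun i => i < m) (iota 0 n) = minn m n.
Proof.
elim: n => [|n IH]; first by rewrite minn0.
by rewrite -addn1 iotaD count_cat IH /= add0n addn0; case: ltnP; lia.
Qed.

Lemma halveE n : halve n = n %/ 2.
Proof.
rewrite /halve (eq_count (a2 := fun i => i < n %/ 2)); last first.
  by move=> i; apply/idP/idP; lia.
by rewrite count_ltn_iota; apply/minn_idPl; lia.
Qed.

Lemma halvesE i n : halves i n = n %/ 2 ^ i.
Proof.
elim: i => [|i IH]; first by rewrite expn0 divn1.
by rewrite /halves iterS -/(halves i n) IH halveE expnSr divnMA.
Qed.

Lemma log2E n : log2 n = trunc_log 2 n.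
Proof.
case: (posnP n) => [->//|Hn].
rewrite /log2 (eq_count (a2 := fun i => i < trunc_log 2 n)).
  rewrite count_ltn_iota; apply/minn_idPl.
  apply: leq_trans (trunc_logP (isT : 1 < 2) Hn).
  exact/ltnW/ltn_expl.
move=> i; rewrite halvesE divn_gt0 ?expn_gt0 //.
apply/idP/idP => H; last by apply: leq_trans (trunc_logP (isT : 1 < 2) Hn); rewrite leq_exp2l.
rewrite ltnNge; apply/negP => Hi.
have := trunc_log_ltn n (isT : 1 < 2); rewrite ltnNge => /negP; apply.
by apply: leq_trans H; rewrite leq_exp2l.
Qed.

Lemma digitsE n : digits n = map sym_nat (encode_nat n).
Proof.
rewrite /digits /encode_nat map_rcons -cats1 log2E -map_comp; congr (_ ++ _).
apply: eq_map => i; rewrite !halvesE expnSr divnMA [RHS]/=.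
by have := divn_eq (n %/ 2 ^ i) 2; rewrite -modn2; lia.
Qed.

Lemma algorithm_digits s :
  flatten [seq digits a | a <- s] = map sym_nat (encode_nats s).
Proof.
rewrite /encode_nats map_flatten -map_comp; congr flatten.
by apply: eq_map => a; rewrite digitsE.
Qed.

Definition bits (m a : nat) : seq symbol := [seq Some (odd (a %/ 2 ^ i)) | i <- iota 0 m].

Lemma bitsS m a : bits m.+1 a = Some (odd a) :: bits m (a %/ 2).
Proof.
rewrite /bits /= expn0 divn1 (iotaDl 1) -map_comp; congr (_ :: _).
by apply: eq_map => i /=; rewrite expnD expn1 divnMA.
Qed.

(** Capping each step equals capping the result, since a partial value that has reached [N] never
    falls below it again. *)
Lemma value_bits N m a : a < 2 ^ m -> value N (rev (map sym_nat (bits m a))) = minn N a.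
Proof.
elim: m a => [|m IH] a Ha.
  by have -> : a = 0 by move: Ha; rewrite expn0; lia.
rewrite bitsS map_cons rev_cons /value foldl_rcons -/(value N _) IH; last first.
  by rewrite ltn_divLR // -expnSr.
have -> : sym_nat (Some (odd a)) = a %% 2 by rewrite /= modn2.
by have := divn_eq a 2; lia.
Qed.

Lemma read_bits N m a toks cur w :
  foldl (read_symbol N) (toks, cur) (map sym_nat (bits m a) ++ w) =
  foldl (read_symbol N) (toks, rev (map sym_nat (bits m a)) ++ cur) w.
Proof.
elim: m a cur => [//|m IH] a cur; rewrite bitsS map_cons rev_cons cat_rcons /= -IH.
by rewrite {2}/read_symbol /=; case: (odd a).
Qed.

Lemma read_nats N s toks :
  foldl (read_symbol N) (toks, [::]) (map sym_nat (encode_nats s)) =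
  (rev (map (minn N) s) ++ toks, [::]).
Proof.
elim: s toks => [//|a s IH] toks.
rewrite -[encode_nats (a :: s)]/(encode_nat a ++ encode_nats s).
rewrite /encode_nat -cats1 -catA map_cat -/(bits (trunc_log 2 a).+1 a) read_bits cats0.
rewrite cat1s map_cons -[LHS]/(foldl (read_symbol N)
  (value N (rev (map sym_nat (bits (trunc_log 2 a).+1 a))) :: toks, [::]) _).
rewrite value_bits; last exact: trunc_log_ltn.
by rewrite IH rev_cons cat_rcons.
Qed.

Lemma parse_nats s : parse (map sym_nat (encode_nats s)) =
  map (minn (size (encode_nats s))) s.
Proof. by rewrite /parse size_map read_nats cats0 revK. Qed.

(** Each number takes at least one symbol, so the input length qualifies as the cap required by
    [N_big]. *)
Lemma size_encode_nats s : size s <= size (encode_nats s).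
Proof.
elim: s => [//|a s IH].
rewrite -[encode_nats (a :: s)]/(encode_nat a ++ encode_nats s) size_cat /encode_nat.
by rewrite size_rcons addSn ltnS; apply: leq_trans IH (leq_addl _ _).
Qed.

Section Instance.
Variables (G : multigraph) (D : divisor G).

Definition instance_data : seq nat := graph_data G ++ divisor_data D.

Definition capped (N : nat) : seq nat := map (minn N) instance_data.

Lemma size_ends (T : Type) (s : seq (T * T)) (f : T -> nat) :
  size (flatten [seq [:: f e.1; f e.2] | e <- s]) = size s + size s.
Proof. by elim: s => //= e s IH; rewrite IH; lia. Qed.

Lemma nth_ends (T : Type) (s : seq (T * T)) (f : T -> nat) r (e0 : T * T) i : i < size s ->
  nth 0 (flatten [seq [:: f e.1; f e.2] | e <- s] ++ r) (i + i) = f (nth e0 s i).1 /\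
  nth 0 (flatten [seq [:: f e.1; f e.2] | e <- s] ++ r) (i + i).+1 = f (nth e0 s i).2.
Proof. by elim: s i => //= e s IH [|i] //= Hi; rewrite addnS /=; apply: IH. Qed.

Lemma size_instance : size instance_data = (size (edges G) + size (edges G) + nverts G).+2.
Proof.
by rewrite size_cat /= size_ends size_map size_enum_ord; lia.
Qed.

Variable N : nat.
Hypothesis N_big : size instance_data <= N.

Lemma nth_capped i : i < size instance_data ->
  nth 0 (capped N) i = minn N (nth 0 instance_data i).
Proof. by move=> Hi; rewrite (nth_map 0). Qed.

Lemma capped_nverts : nth 0 (capped N) 0 = nverts G.
Proof.
rewrite nth_capped ?size_instance //; apply/minn_idPr.
by apply: leq_trans N_big; rewrite size_instance /=; lia.
Qed.

Lemma capped_size : nth 0 (capped N) 1 = size (edges G).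
Proof.
rewrite nth_capped ?size_instance //; apply/minn_idPr.
by apply: leq_trans N_big; rewrite size_instance /=; lia.
Qed.

Lemma capped_edges : input_edges (capped N) = nat_edges G.
Proof.
rewrite /input_edges capped_size /nat_edges.
case Es : (edges G) => [//|e0 s]; rewrite -Es.
apply: (@eq_from_nth _ (0, 0)); first by rewrite !size_map size_iota.
move=> i; rewrite size_map size_iota => Hi.
rewrite nth_tabulate // (nth_map e0) // !nth_capped ?size_instance; try by lia.
have [H1 H2] := @nth_ends _ (edges G) val (divisor_data D) e0 i Hi.
rewrite /instance_data /graph_data /= H1 H2.
have := ltn_ord (nth e0 (edges G) i).1; have := ltn_ord (nth e0 (edges G) i).2.
move: N_big; rewrite size_instance => HN Ha Hb.
by congr (_, _); apply/minn_idPr => /=; lia.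
Qed.

Lemma capped_divisor : input_divisor (capped N) =
  [seq minn N `|D v ord0|%N | v <- enum 'I_(nverts G)].
Proof.
rewrite /input_divisor capped_nverts capped_size.
apply: (@eq_from_nth _ 0); first by rewrite size_map size_iota size_map size_enum_ord.
move=> i; rewrite size_map size_iota => Hi.
rewrite nth_tabulate // nth_capped; last by rewrite size_instance; lia.
rewrite (nth_map (Ordinal Hi)) ?size_enum_ord //; congr minn.
rewrite /instance_data /graph_data /= nth_cat size_ends ltnNge leq_addr /= addKn.
by rewrite /divisor_data (nth_map (Ordinal Hi)) ?size_enum_ord.
Qed.

End Instance.

Lemma instance_decomposition (G : multigraph) (D : divisor G) (k : nat) (N : nat) :
  connected G -> effective D -> div_degree D = Posz k -> rank_ge1 D ->
  size (instance_data D) <= N ->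
  exists (T : multigraph) (X : vertex T -> {set vertex G}),
    [/\ tree_decomposition X, width X <= k &
        solve (capped D N) = graph_data T ++
          flatten [seq [seq nat_of_bool (v \in X i) | v <- enum 'I_(nverts G)]
                  | i <- enum 'I_(nverts T)]].
Proof.
move=> Hc Heff Hdeg Hrank HN.
have Hn : 0 < nverts G by case: Hc.
pose d := input_divisor (capped D N).
pose K := keys (nverts G) (nat_edges G) d.
exists (dtree K Hn), (@obag G (@kbefore G K)); split.
- exact: (dtree_decomposition K Hn).
- suff H v : #|@obag G (@kbefore G K) v| <= k.+1.
    rewrite /width; have : \max_i #|@obag G (@kbefore G K) i| <= k.+1 by apply/bigmax_leqP => i _.
    by move: (\max_i _); lia.
  (* If [k] is at least the number of vertices, any bag is small enough, whatever the capped chip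
     numbers did to the keys. *)
  have [Hkn|Hkn] := ltnP k (nverts G); last first.
    by apply: leq_trans (max_card _) _; rewrite card_ord; exact: leqW.
  (* Now each chip number is at most [k], hence below the number of vertices and the cap [N], and
     has been read correctly. *)
  have Hd v' : fun_of G d v' = `|D v' ord0|%N.
    rewrite ffunE /d capped_divisor // (nth_map v') ?size_enum_ord // nth_ord_enum.
    apply/minn_idPr; move: HN; rewrite size_instance.
    have : ((`|D v' ord0|%N)%:Z <= k%:Z)%R.
      rewrite gez0_abs ?Heff // -Hdeg /div_degree (bigD1 v') //= lerDl.
      by apply: sumr_ge0 => u _; exact: Heff.
    by rewrite lez_nat; lia.
  have Ecol : (\col_u (fun_of G d u)%:Z)%R = D.
    by apply/colP => u; rewrite mxE Hd gez0_abs // Heff.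
  have Hdk : deg (fun_of G d) = k.
    apply/eqP; rewrite -eqz_nat Posz_deg -Hdeg; apply/eqP; apply: eq_bigr => u _.
    by rewrite Hd gez0_abs // Heff.
  rewrite -Hdk.
  have Hdn : deg (fun_of G d) < nverts G by rewrite Hdk.
  have Hrk : rank_ge1 (\col_u (fun_of G d u)%:Z : divisor G)%R by rewrite Ecol.
  have Efst (u : vertex G) : kfst K u = hit (nverts G) (nat_edges G) d u.
    by rewrite /kfst (nth_tabulate _ (fun i => (_, _))).
  have Esnd (u : vertex G) : ksnd K u = spark (nverts G) (nat_edges G) d u.
    by rewrite /ksnd (nth_tabulate _ (fun i => (_, _))).
  apply: (@bag_size G (fun_of G d) (kfst K) (ksnd K) _ _ v).
  + by move=> u r; rewrite Efst; apply: hitP.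
  + by move=> u; rewrite Efst Esnd; apply: sparkP.
  move=> y; rewrite inE => /orP[/eqP|/andP[Hy /existsP[w /andP[Hyw Hw]]]]; first by left.
  by right; split=> //; exists w.
- rewrite /solve capped_nverts // capped_edges // -/d -/K.
  by rewrite (decompositionE K Hn).
Qed.

Theorem theorem2 :
  exists (M : machine symbol) (p : {poly nat}),
    forall (G : multigraph) (D : divisor G) (k : nat),
      connected G ->
      effective D ->
      div_degree D = Posz k ->
      rank_ge1 D ->
      exists (T : multigraph) (X : vertex T -> {set vertex G}),
        [/\ tree_decomposition X,
            width X <= k
          & exists2 t : nat,
              t <= horner p (size (encode_instance D))
            & outputs_within M (encode_instance D) t (encode_decomposition X)].
Proof.
have [M [p HM]] := FP_machine FP_algorithm.
exists M, p => G D k Hc Heff Hdeg Hrank.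
have HN := size_encode_nats (instance_data D).
have [T [X [HT HX HE]]] := instance_decomposition Hc Heff Hdeg Hrank HN.
exists T, X; split=> //; apply: HM.
by rewrite /algorithm parse_nats -/(capped _ _) HE algorithm_digits.
Qed.
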